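(* Let $r$ be a positive integer and let $\Sigma$ be a set of laws (of the form described in the context) such that $\Sigma$ is valid and $U_r(\Sigma)$ is bounded. Then the geometric realisation $|\mathfrak{A}_r(\Sigma)|$ of the poset of admissible subsets of $U_r(\Sigma)$, with the action of $G_r(\Sigma)$ induced by $Y\mapsto Yg$, is a model for $\underline{E}G_r(\Sigma)$, the classifying space for proper actions of $G_r(\Sigma)$.
   Context: Cantor algebras. Fix finitely many colours $\{1,\ldots,s\}$, each colour $i$ having an arity, an integer $n_i>1$. An $\Omega$-algebra is a set $U$ with, for each colour $i$, an $n_i$-ary operation $\lambda_i:U^{n_i}\to U$ and $n_i$ unary operations $\alpha_i^1,\ldots,\alpha_i^{n_i}:U\to U$ (operations act on the right); write $v\alpha_i=(v\alpha_i^1,\ldots,v\alpha_i^{n_i})$. For a subset $Y$, a simple expansion of colour $i$ replaces one element $y\in Y$ by the $n_i$ elements $y\alpha_i^1,\ldots,y\alpha_i^{n_i}$; a simple contraction of colour $i$ replaces $n_i$ distinct elements $a_1,\ldots,a_{n_i}$ of $Y$ by the single element $(a_1,\ldots,a_{n_i})\lambda_i$. Let $X$ be a finite set with $|X|=r$ and $W_\Omega(X)$ the free $\Omega$-algebra on $X$. A subset of $W_\Omega(X)$ (or of a quotient of it) is admissible if it is obtained from $X$ (or its image) by finitely many simple expansions and contractions. Let $\Sigma=\Sigma_1\cup\Sigma_2$, where $\Sigma_1$ consists of the laws $u\alpha_i\lambda_i=u$ and $(u_1,\ldots,u_{n_i})\lambda_i\alpha_i=(u_1,\ldots,u_{n_i})$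 for all colours $i$, and $\Sigma_2=\bigcup_{1\le i<i'\le s}\Sigma_2^{i,i'}$, where each $\Sigma_2^{i,i'}$ is either empty or is of the following form: for some maps $f:\{1,\ldots,n_i\}\to\{1,\ldots,s\}$ and $f':\{1,\ldots,n_{i'}\}\to\{1,\ldots,s\}$ put $\Lambda_i=\{\alpha_i^j\alpha_{f(j)}^k: 1\le j\le n_i,\,1\le k\le n_{f(j)}\}$ and $\Lambda_{i'}=\{\alpha_{i'}^j\alpha_{f'(j)}^k: 1\le j\le n_{i'},\,1\le k\le n_{f'(j)}\}$ (sets of length 2 sequences of descending operations), fix a bijection $\phi:\Lambda_i\to\Lambda_{i'}$, and let $\Sigma_2^{i,i'}$ be the set of laws $u\nu=u\phi(\nu)$, $\nu\in\Lambda_i$. The Cantor algebra $U_r(\Sigma)$ is the quotient of $W_\Omega(X)$ by the fully invariant congruence generated by $\Sigma$. $\Sigma$ (or $U_r(\Sigma)$) is valid if every admissible $Y\subseteq W_\Omega(X)$ has the same cardinality as its image in $U_r(\Sigma)$. In that case $U_r(\Sigma)$ is free on $X$ in the class of $\Omega$-algebras satisfying $\Sigma$, and every admissible subset is a basis. For admissible subsets $Y,Z$ of $U_r(\Sigma)$ write $Y\le Z$ if $Z$ is obtained from $Y$ by a finite number of simple expansions. The set $\mathfrak{A}_r(\Sigma)$ of admissible subsets of $U_r(\Sigma)$ is a poset under $\le$. $U_r(\Sigma)$ is bounded if for all admissible $B,C$ for which there is an admissible $A$ with $A\le B$ and $A\le C$, there is a unique least upper bound of $B$ and $C$, i.e.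 an admissible $T$ with $B\le T$, $C\le T$ and $T\le S$ for every admissible $S$ with $B\le S$, $C\le S$. $G_r(\Sigma)$ is the group of those $\Omega$-algebra automorphisms of $U_r(\Sigma)$ which are induced by a bijection $V\to W$ between admissible subsets of the same cardinality; it acts on the right on $\mathfrak{A}_r(\Sigma)$ by $Y\mapsto Yg$. A $G$-CW-complex $Z$ is a model for $\underline{E}G$ if the fixed point set $Z^H$ is contractible for every finite subgroup $H\le G$ and empty for every infinite subgroup $H\le G$. *)

(* Defs.v *)
From HB Require Import structures.
From mathcomp Require Import all_boot all_order all_algebra finmap.
From mathcomp Require Import all_classical all_reals all_analysis.

Set Implicit Arguments.
Unset Strict Implicit.
Unset Printing Implicit Defensive.

Import Order.TTheory GRing.Theory Num.Theory.
Local Open Scope classical_set_scope.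

Record signature := Signature {
  ncol : nat;
  arity : 'I_ncol -> nat;
  arity_gt1 : forall i, (1 < arity i)%N }.

Record omega_algebra (O : signature) := OmegaAlgebra {
  carrier :> Type;
  lam : forall i : 'I_(ncol O), ('I_(arity i) -> carrier) -> carrier;
  alp : forall i : 'I_(ncol O), 'I_(arity i) -> carrier -> carrier }.
Arguments lam {O o} i _ : simpl never.
Arguments alp {O o} i _ _ : simpl never.

Section Algebra.
Variables (O : signature) (A : omega_algebra O).
Implicit Types (X Y Z : set A).

Definition simple_expansion Y Z := exists i (y : A),
  Y y /\ Z = (Y `\ y) `|` range (fun j => alp i j y).

Definition simple_contraction Y Z := exists i (a : 'I_(arity i) -> A),
  [/\ injective a, range a `<=` Y & Z = (Y `\` range a) `|` [set lam i a]].

Inductive admissible X : set A -> Prop :=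
| adm_base : admissible X X
| adm_exp Y Z : admissible X Y -> simple_expansion Y Z -> admissible X Z
| adm_con Y Z : admissible X Y -> simple_contraction Y Z -> admissible X Z.

Inductive expansion Y : set A -> Prop :=
| expansion_refl : expansion Y Y
| expansion_step Z T : expansion Y Z -> simple_expansion Z T -> expansion Y T.

Definition is_hom (B : omega_algebra O) (g : A -> B) :=
  (forall i (a : 'I_(arity i) -> A), g (lam i a) = lam i (g \o a)) /\
  (forall i j (u : A), g (alp i j u) = alp i j (g u)).

End Algebra.

(* The sequence alpha_i^j alpha_(f j)^k is encoded by the pair (j, k). *)
Record law2 (O : signature) (i i' : 'I_(ncol O)) := Law2 {
  lf : 'I_(arity i) -> 'I_(ncol O);
  lf' : 'I_(arity i') -> 'I_(ncol O);
  lphi : {j : 'I_(arity i) & 'I_(arity (lf j))} ->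
         {j : 'I_(arity i') & 'I_(arity (lf' j))};
  lphi_bij : bijective lphi }.

(* [None] means that Sigma_2^(i,i') is empty. *)
Definition laws2 (O : signature) :=
  forall i i' : 'I_(ncol O), (i < i')%N -> option (law2 i i').

Section Laws.
Variables (O : signature) (S : laws2 O) (A : omega_algebra O).

(* All instances in A of the laws in Sigma = Sigma_1 + S. *)
Inductive law_instance : A -> A -> Prop :=
| law_alp_lam i (u : A) : law_instance (lam i (fun j => alp i j u)) u
| law_lam_alp i (u : 'I_(arity i) -> A) j :
    law_instance (alp i j (lam i u)) (u j)
| law_S (i i' : 'I_(ncol O)) (lt_ii' : (i < i')%N) (L : law2 i i') (nu : {j & 'I_(arity (lf L j))}) (u : A) :
    S lt_ii' = Some L ->
    law_instance (alp (lf L (tag nu)) (tagged nu) (alp i (tag nu) u))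
      (alp (lf' L (tag (lphi nu))) (tagged (lphi nu))
         (alp i' (tag (lphi nu)) u)).

(* The set of all instances is stable under endomorphisms, hence so is the
   congruence which it generates. *)
Inductive law_cong : A -> A -> Prop :=
| cong_law u v : law_instance u v -> law_cong u v
| cong_refl u : law_cong u u
| cong_sym u v : law_cong u v -> law_cong v u
| cong_trans u v w : law_cong u v -> law_cong v w -> law_cong u w
| cong_lam i (a b : 'I_(arity i) -> A) :
    (forall j, law_cong (a j) (b j)) -> law_cong (lam i a) (lam i b)
| cong_alp i j u v : law_cong u v -> law_cong (alp i j u) (alp i j v).

End Laws.

(* W_Omega(X) for X = {1, ..., r}. *)
Section Free.
Variables (O : signature) (r : nat).

Inductive term : Type :=
| Var of 'I_r
| Lam i of ('I_(@arity O i) -> term)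
| Alp i of 'I_(@arity O i) & term.

HB.instance Definition _ := gen_eqMixin term.
HB.instance Definition _ := gen_choiceMixin term.

Definition free_algebra : omega_algebra O := @OmegaAlgebra O term Lam Alp.

End Free.
Arguments Var {O r}.

Section Cantor.
Variables (O : signature) (S : laws2 O) (r : nat).
Local Notation W := (free_algebra O r).

Definition cantor_rel : rel (term O r) :=
  fun u v => `[< law_cong S (u : W) (v : W) >].

Fact cantor_rel_refl : reflexive cantor_rel.
Proof. by move=> u; apply/asboolP/cong_refl. Qed.
Fact cantor_rel_sym : symmetric cantor_rel.
Proof. by move=> u v; apply/asboolP/asboolP => /cong_sym. Qed.
Fact cantor_rel_trans : transitive cantor_rel.
Proof.
move=> v u w /asboolP uv /asboolP vw; apply/asboolP; exact: cong_trans uv vw.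
Qed.

Canonical cantor_equiv :=
  EquivRel cantor_rel cantor_rel_refl cantor_rel_sym cantor_rel_trans.

Definition cantor_carrier := {eq_quot cantor_equiv}%qT.

Definition cantor_pi (u : W) : cantor_carrier := \pi_cantor_carrier%qT u.

Definition cantor_algebra : omega_algebra O := @OmegaAlgebra O cantor_carrier
  (fun i a => cantor_pi (Lam (fun j => repr (a j))))
  (fun i j u => cantor_pi (Alp j (repr u))).
Local Notation U := cantor_algebra.

Definition W_admissible : set W -> Prop := admissible (range Var : set W).
Definition U_admissible : set U -> Prop :=
  admissible (range (fun x => cantor_pi (Var x)) : set U).

Definition valid := forall Y, W_admissible Y -> (Y #= cantor_pi @` Y)%card.

Record adm := Adm { adm_set :> set U; adm_setP : U_admissible adm_set }.

HB.instance Definition _ := gen_eqMixin adm.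
HB.instance Definition _ := gen_choiceMixin adm.

Definition adm_le (Y Z : adm) := expansion Y Z.

Definition is_adm_lub (B C T : adm) := [/\ adm_le B T, adm_le C T &
  forall D : adm, adm_le B D -> adm_le C D -> adm_le T D].

Definition bounded := forall B C : adm,
  (exists A : adm, adm_le A B /\ adm_le A C) -> exists! T, is_adm_lub B C T.

Definition induced (g : U -> U) := exists V W : set U,
  [/\ U_admissible V, U_admissible W, (V #= W)%card & set_bij V W g].

Record cantor_aut := CantorAut {
  aut_fun :> U -> U;
  aut_bij : bijective aut_fun;
  aut_hom : is_hom aut_fun;
  aut_induced : induced aut_fun }.

(* Validity makes the elements of [cantor_aut] act on [adm]: simple
   expansions and contractions of admissible subsets of U undo each other. *)

Lemma adm_eq (Y Z : adm) : Y = Z :> set U -> Y = Z.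
Proof.
case: Y Z => [Y hY] [Z hZ] /= eYZ; rewrite -{}eYZ in hZ *.
by rewrite (Prop_irrelevance hY hZ).
Qed.

Lemma cantor_pi_eq (u v : W) : cantor_pi u = cantor_pi v <-> law_cong S u v.
Proof.
split=> [/eqP|uv]; first by rewrite /cantor_pi eqmodE /= => /asboolP.
by apply/eqP; rewrite /cantor_pi eqmodE /=; apply/asboolP.
Qed.

Lemma repr_pi (u : W) : law_cong S (repr (cantor_pi u) : W) u.
Proof. by apply/cantor_pi_eq; rewrite /cantor_pi reprK. Qed.

Lemma cantor_pi_hom : is_hom (cantor_pi : W -> U).
Proof.
split=> [i a|i j u] /=; apply/cantor_pi_eq.
  by apply: (@cong_lam O S W) => j; apply/cong_sym/repr_pi.
by apply/(@cong_alp O S W)/cong_sym/repr_pi.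
Qed.

Lemma U_alp_lam i (u : U) : lam i (fun j => alp i j u) = u.
Proof.
rewrite -[RHS](reprK (T := term O r)); apply/cantor_pi_eq.
apply: cong_trans (cong_law (law_alp_lam S i (repr u : W))).
by apply: (@cong_lam O S W) => j; apply: repr_pi.
Qed.

Lemma U_lam_alp i (a : 'I_(arity i) -> U) j : alp i j (lam i a) = a j.
Proof.
rewrite -[RHS](reprK (T := term O r)); apply/cantor_pi_eq.
apply: cong_trans (cong_law (law_lam_alp S (fun j => repr (a j) : W) j)).
by apply: (@cong_alp O S W); apply: repr_pi.
Qed.

Fixpoint subterm (v u : term O r) : Prop := v = u \/
  match u with
  | Var _ => False
  | Lam i a => exists j, subterm v (a j)
  | Alp i j u => subterm v u
  end.

Lemma subterm_refl u : subterm u u. Proof. by case: u => *; left. Qed.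

Lemma subterm_trans v u w : subterm u v -> subterm v w -> subterm u w.
Proof.
move=> uv; elim: w => [x|i a IH|i j w IH] [e|]; try by rewrite -e.
- by [].
- by move=> [j /IH]; right; exists j.
- by move=> /IH; right.
Qed.

Fixpoint height (u : term O r) : nat :=
  match u with
  | Var _ => 0
  | Lam i a => (\max_j height (a j)).+1
  | Alp i j u => (height u).+1
  end.

Lemma subterm_height v u : subterm v u -> v = u \/ (height v < height u)%N.
Proof.
elim: u => [x|i a IH|i j u IH] /= [->|//]; try by left.
- move=> [j /IH le_vj]; right; rewrite ltnS; apply: (@leq_trans (height (a j))).
    by case: le_vj => [->|/ltnW].
  exact: (leq_bigmax j).
- move=> /IH le_vu; right; rewrite ltnS.
  by case: le_vu => [->|/ltnW].
Qed.

Lemma subterm_anti u v : subterm u v -> subterm v u -> u = v.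
Proof.
move=> /subterm_height[//|uv] /subterm_height[//|vu].
by have := ltn_trans uv vu; rewrite ltnn.
Qed.

Lemma W_antichain Y : W_admissible Y ->
  forall u v, Y u -> Y v -> subterm u v -> u = v.
Proof.
elim=> {Y} [|Y Z _ IH [i [y [Yy ->]]]|Y Z _ IH [i [a [a_inj aY ->]]]].
- by move=> _ _ [x _ <-] [y _ <-] /= [//|].
- have sA (j : 'I_(arity i)) : subterm y (Alp j y : W) by right; apply: subterm_refl.
  move=> u v [[Yu uy]|[j _ <-]] [[Yv vy]|[k _ <-]].
  + exact: IH.
  + by move=> /= [//|uy']; case: uy; apply: IH.
  + by move=> /(subterm_trans (sA j)) yv; case: vy; rewrite /=; apply/esym/IH.
  + move=> /= [//|/(subterm_height)[e|]].
      by have := congr1 height e => /= /eqP; rewrite gtn_eqF.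
    by rewrite /= ltnNge leqnSn.
- have sL j : subterm (a j) (Lam a : W).
    by right; exists j; apply: subterm_refl.
  have Ya j : Y (a j) by apply: aY; exists j.
  move=> u v [[Yu ua]|->] [[Yv va]|->] //.
  + exact: IH.
  + by move=> /= [//|[j /(IH _ _ Yu (Ya j))uj]]; case: ua; exists j.
  + pose j0 := Ordinal (ltnW (arity_gt1 i)).
    move=> /(subterm_trans (sL j0)) /(IH _ _ (Ya j0) Yv) vj.
    by case: va; exists j0.
Qed.

Lemma W_finite Y : W_admissible Y -> finite_set Y.
Proof.
elim=> {Y} [|Y Z _ IH [i [y [Yy ->]]]|Y Z _ IH [i [a [a_inj aY ->]]]].
- by apply: finite_image; exact: finite_finset.
- rewrite finite_setU; split; first exact: finite_setD.
  by apply: finite_image; exact: finite_finset.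
- by rewrite finite_setU; split; [exact: finite_setD|exact: finite_set1].
Qed.

Lemma valid_inj Y : valid -> W_admissible Y ->
  forall u v, Y u -> Y v -> cantor_pi u = cantor_pi v -> u = v.
Proof.
move=> hv admY u v Yu Yv euv; apply: contrapT => neq_uv.
have finY : finite_set (Y : set (term O r)) := W_finite admY.
have imY : cantor_pi @` Y = cantor_pi @` (Y `\ v).
  apply/seteqP; split=> [_ [w Yw <-]|_ [w [Yw _] <-]]; last by exists w.
  have [->|neq_wv] := pselect (w = v); last by exists w.
  by exists u.
have leY : (Y #<= Y `\ v)%card.
  have := hv _ admY; rewrite card_eq_le => /andP[/card_le_trans + _]; apply.
  by rewrite imY; apply: card_image_le.
have [n Yn] := finY.
have [m Ym] : finite_set (Y `\ v : set (term O r)) by exact: finite_setD.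
have le_nm : (n <= m)%N.
  by rewrite -card_le_II -(card_le_eql Yn) -(card_le_eqr Ym).
have /fproper_ltn_card :
    (fset_set (Y `\ v : set (term O r)) `<` fset_set (Y : set (term O r)))%fset.
  rewrite fproperE; apply/andP; split.
    apply/fsubsetP => w; rewrite !in_fset_set ?inE//; last exact: finite_setD.
    by case.
  apply/negP => /fsubsetP/(_ v); rewrite !in_fset_set ?inE//;
    last exact: finite_setD.
  by move=> /(_ Yv) [_]; apply.
by rewrite (card_fset_set Yn) (card_fset_set Ym) ltnNge le_nm.
Qed.

(* Simple expansions and contractions in U lift to W. *)
Lemma U_admissible_lift Y : valid -> U_admissible Y ->
  exists2 Y' : set W, W_admissible Y' & cantor_pi @` Y' = Y.
Proof.
have [pi_lam pi_alp] := cantor_pi_hom.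
move=> hv; elim=> {Y}
  [|Y Z _ [Y' admY' eY'] [i [y [Yy ->]]]
   |Y Z _ [Y' admY' eY'] [i [a [a_inj aY ->]]]].
- exists (range Var); first exact: adm_base.
  by rewrite image_comp.
- have inj := valid_inj hv admY'.
  move: Yy; rewrite -eY' => -[y' Yy' <-].
  exists ((Y' `\ y') `|` range (fun j => alp i j y')).
    by apply: (adm_exp admY'); exists i, y'.
  rewrite image_setU image_comp; congr (_ `|` _).
    apply/seteqP; split=> [_ [u [Yu uy] <-]|_ [[u Yu <-] uy]].
      by split=> [|e]; [exists u|apply: uy; apply: inj].
    by exists u => //; split=> // e; apply: uy; rewrite /= e.
  by congr (_ @` _); apply/funext => j; exact: (pi_alp i j y').
- have inj := valid_inj hv admY'.
  have /choice[a' ha'] : forall j, exists u, Y' u /\ cantor_pi u = a j.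
    by move=> j; have := aY (a j) (ex_intro2 _ _ j I erefl);
      rewrite -eY' => -[u Yu <-]; exists u.
  have ea : a = cantor_pi \o a' by apply/funext => j /=; case: (ha' j).
  exists ((Y' `\` range a') `|` [set (lam i a' : W)]).
    apply: (adm_con admY'); exists i, a'; split=> //.
      by move=> j k e; apply: a_inj; rewrite ea /= e.
    by move=> _ [j _ <-]; case: (ha' j).
  rewrite image_setU image_set1 pi_lam -ea -eY'; congr (_ `|` _).
  apply/seteqP; split=> [_ [u [Yu ua] <-]|_ [[u Yu <-] ua]].
    split; first by exists u.
    move=> [j _ e]; apply: ua; exists j => //.
    have [Yj ej] := ha' j; apply: inj => //.
    by rewrite ej.
  exists u => //; split=> // -[j _ e]; apply: ua; exists j => //.
  by rewrite -e ea.
Qed.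

Lemma U_alp_free Y i y : valid -> U_admissible Y -> Y y ->
  injective (fun j => alp i j y) /\
  forall j, Y (alp i j y) -> alp i j y = y.
Proof.
have [_ pi_alp] := cantor_pi_hom.
move=> hv admY Yy; have [Y' admY' eY'] := U_admissible_lift hv admY.
move: Yy; rewrite -eY' => -[y' Yy' <-].
have admZ : W_admissible ((Y' `\ y') `|` range (fun j => alp i j y')).
  by apply: (adm_exp admY'); exists i, y'.
have inj := valid_inj hv admZ; have anti := W_antichain admY'.
have Za j : ((Y' `\ y') `|` range (fun j => alp i j y')) (alp i j y').
  by right; exists j.
split=> [j k|j [u Yu]] /=; rewrite -!pi_alp.
  move=> /(inj _ _ (Za j) (Za k)) e.
  have [] : Alp j y' = Alp k y' by exact: e.
  exact: eq_from_Tagged.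
have [->//|neq_uy e] := pselect (u = y').
have eu : u = alp i j y' by apply: inj => //; left.
case: neq_uy; apply/esym/(anti y' u) => //.
by rewrite eu; right; apply: subterm_refl.
Qed.

Lemma U_lam_free Y i (a : 'I_(arity i) -> U) : valid -> U_admissible Y ->
  injective a -> range a `<=` Y -> Y (lam i a) -> range a (lam i a).
Proof.
have [pi_lam _] := cantor_pi_hom.
move=> hv admY a_inj aY Ya; have [Y' admY' eY'] := U_admissible_lift hv admY.
have /choice[a' ha'] : forall j, exists u, Y' u /\ cantor_pi u = a j.
  by move=> j; have := aY (a j) (ex_intro2 _ _ j I erefl);
    rewrite -eY' => -[u Yu <-]; exists u.
have ea : a = cantor_pi \o a' by apply/funext => j /=; case: (ha' j).
move: Ya; rewrite -eY' => -[u Yu eu].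
have admZ : W_admissible ((Y' `\` range a') `|` [set (lam i a' : W)]).
  apply: (adm_con admY'); exists i, a'; split=> //.
    by move=> j k e; apply: a_inj; rewrite ea /= e.
  by move=> _ [j _ <-]; case: (ha' j).
apply: contrapT => nea.
have ua' : ~ range a' u.
  by move=> [j _ e]; apply: nea; exists j => //; rewrite -eu -e ea.
have eua : u = lam i a'.
  apply: (valid_inj hv admZ); [by left|by right|].
  by rewrite eu pi_lam -ea.
pose j0 := Ordinal (ltnW (arity_gt1 i)).
apply: ua'; exists j0 => //; apply: (W_antichain admY') => //.
  by case: (ha' j0).
by rewrite eua; right; exists j0; apply: subterm_refl.
Qed.

Lemma U_exp_rev Y Z : valid -> U_admissible Y ->
  simple_expansion Y Z -> simple_contraction Z Y.
Proof.
move=> hv admY [i [y [Yy ->]]]; exists i, (fun j => alp i j y).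
have [inj free] := U_alp_free i hv admY Yy.
split; [exact: inj|exact: subsetUr|].
rewrite U_alp_lam; apply/seteqP; split=> u.
  have [->|neq_uy] := pselect (u = y); first by right.
  move=> Yu; left; split; first by left.
  by move=> [j _ e]; apply: neq_uy; rewrite -e free // e.
by move=> [[[[]|//]]|->].
Qed.

Lemma U_con_rev Y Z : valid -> U_admissible Y ->
  simple_contraction Y Z -> simple_expansion Z Y.
Proof.
move=> hv admY [i [a [a_inj aY ->]]]; exists i, (lam i a); split; first by right.
have -> : (fun j => alp i j (lam i a)) = a.
  by apply/funext => j; rewrite U_lam_alp.
apply/seteqP; split=> u.
  have [|nau] := pselect (range a u); first by right.
  move=> Yu; left; split; first by left.
  by move=> /= e; apply: nau; rewrite e; apply: U_lam_free hv admY _ _ _; rewrite -?e.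
by move=> [[[[]//|->] /(_ erefl)]|/aY].
Qed.

Lemma U_admissible_sym V Y : valid -> U_admissible V ->
  admissible V Y -> U_admissible Y /\ admissible Y V.
Proof.
move=> hv admV; have admT X1 X2 X3 : admissible X1 X2 -> admissible X2 X3 ->
    admissible X1 (X3 : set U).
  move=> h12; elim=> // A B _ h1A; [exact: adm_exp h1A|exact: adm_con h1A].
elim=> {Y} [|Y Z _ [admY YV] YZ|Y Z _ [admY YV] YZ].
- by split=> //; apply: adm_base.
- split; first exact: adm_exp admY YZ.
  apply: admT YV; apply: adm_con (adm_base Z) _; exact: U_exp_rev.
- split; first exact: adm_con admY YZ.
  apply: admT YV; apply: adm_exp (adm_base Z) _; exact: U_con_rev.
Qed.

Lemma U_admissible_reach V Y : valid -> U_admissible V -> U_admissible Y ->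
  admissible V Y.
Proof.
move=> hv admV admY.
have [_ VX] := U_admissible_sym hv (adm_base _) admV.
elim: admY => // A B _ hA; [exact: adm_exp hA|exact: adm_con hA].
Qed.

Lemma image_expansion (g : U -> U) Y Z : bijective g -> is_hom g ->
  simple_expansion Y Z -> simple_expansion (g @` Y) (g @` Z).
Proof.
move=> /bij_inj g_inj [g_lam g_alp] [i [y [Yy ->]]]; exists i, (g y).
split; first by exists y.
rewrite image_setU image_comp; congr (_ `|` _).
  apply/seteqP; split=> [_ [u [Yu uy] <-]|_ [[u Yu <-] uy]].
    by split=> [|e]; [exists u|apply: uy; apply: g_inj].
  by exists u => //; split=> // e; apply: uy; rewrite /= e.
by congr (_ @` _); apply/funext => j; apply: g_alp.
Qed.

Lemma image_contraction (g : U -> U) Y Z : bijective g -> is_hom g ->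
  simple_contraction Y Z -> simple_contraction (g @` Y) (g @` Z).
Proof.
move=> /bij_inj g_inj [g_lam g_alp] [i [a [a_inj aY ->]]].
exists i, (g \o a); split.
- by move=> j k /g_inj/a_inj.
- by move=> _ [j _ <-]; exists (a j) => //; apply: aY; exists j.
rewrite image_setU image_set1 g_lam; congr (_ `|` _).
apply/seteqP; split=> [_ [u [Yu ua] <-]|_ [[u Yu <-] ua]].
  by split=> [|[j _ /g_inj e]]; [exists u|apply: ua; exists j].
by exists u => //; split=> // -[j _ e]; apply: ua; exists j => //=; rewrite e.
Qed.

Lemma aut_admissible (g : cantor_aut) Y : valid ->
  U_admissible Y -> U_admissible (g @` Y).
Proof.
move=> hv admY; have [V [V' [admV admV' _ gVV']]] := aut_induced g.
have gV : g @` V = V' by case: gVV' => gV _ gS; apply: surj_image_eq gS => _ [u Vu <-]; exact: gV.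
have := U_admissible_reach hv admV admY; elim=> {admY Y}.
- by rewrite gV.
- move=> Y Z _ h YZ; apply: adm_exp h _.
  by apply: image_expansion YZ; [exact: aut_bij|exact: aut_hom].
- move=> Y Z _ h YZ; apply: adm_con h _.
  by apply: image_contraction YZ; [exact: aut_bij|exact: aut_hom].
Qed.

End Cantor.

Section CantorGroup.
Variables (O : signature) (S : laws2 O) (r : nat) (hv : valid S r).
Local Notation U := (cantor_algebra S r).
Local Notation aut := (cantor_aut S r).

Lemma aut_eq (g h : aut) : g =1 h -> g = h.
Proof.
case: g h => [g g1 g2 g3] [h h1 h2 h3] /= /funext e.
rewrite -{}e in h1 h2 h3 *.
by rewrite (Prop_irrelevance h1 g1) (Prop_irrelevance h2 g2)
  (Prop_irrelevance h3 g3).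
Qed.

Lemma inducedI (g : U -> U) V :
  bijective g -> U_admissible V -> U_admissible (g @` V) -> induced g.
Proof.
move=> /bij_inj g_inj admV admgV; exists V, (g @` V); split=> //.
  by apply/card_esym/inj_card_eq => u v _ _; apply: g_inj.
by apply: inj_bij => u v _ _; apply: g_inj.
Qed.

Let X_adm : U_admissible (range (fun x => cantor_pi S (Var x)) : set U) :=
  adm_base _.

Fact aut1_induced : induced (id : U -> U).
Proof.
by apply: inducedI X_adm _; [exists id|rewrite image_id; apply: X_adm].
Qed.

Fact aut1_hom : is_hom (id : U -> U).
Proof. by split. Qed.

Definition aut1 : aut :=
  CantorAut (Bijective (frefl _) (frefl _)) aut1_hom aut1_induced.

Fact autM_hom (g h : aut) : is_hom (h \o g).
Proof.
have [g_lam g_alp] := aut_hom g; have [h_lam h_alp] := aut_hom h.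
by split=> [i a|i j u] /=; rewrite ?g_lam ?h_lam ?g_alp ?h_alp.
Qed.

Fact autM_induced (g h : aut) : induced (h \o g).
Proof.
apply: inducedI X_adm _; first exact: bij_comp (aut_bij h) (aut_bij g).
by rewrite -image_comp; do 2![apply: aut_admissible hv _].
Qed.

(* Right actions: g * h means g followed by h. *)
Definition autM (g h : aut) : aut :=
  CantorAut (bij_comp (aut_bij h) (aut_bij g)) (autM_hom g h)
    (autM_induced g h).

Fact autV_ex (g : aut) : exists h : U -> U, cancel g h /\ cancel h g.
Proof. by have [h gK hK] := aut_bij g; exists h. Qed.

Definition autV_fun (g : aut) : U -> U := sval (cid (autV_ex g)).

Lemma autV_funK (g : aut) : cancel g (autV_fun g).
Proof. by rewrite /autV_fun; case: cid => h []. Qed.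

Lemma autV_funVK (g : aut) : cancel (autV_fun g) g.
Proof. by rewrite /autV_fun; case: cid => h []. Qed.

Fact autV_bij (g : aut) : bijective (autV_fun g).
Proof. by exists g; [exact: autV_funVK|exact: autV_funK]. Qed.

Fact autV_hom (g : aut) : is_hom (autV_fun g).
Proof.
have [g_lam g_alp] := aut_hom g; have g_inj := bij_inj (aut_bij g).
split=> [i a|i j u]; apply: g_inj; rewrite ?g_lam ?g_alp !autV_funVK //.
by congr lam; apply/funext => j /=; rewrite autV_funVK.
Qed.

Fact autV_induced (g : aut) : induced (autV_fun g).
Proof.
apply: inducedI (aut_admissible g hv X_adm) _; first exact: autV_bij.
rewrite image_comp (_ : _ \o _ = id) ?image_id //.
by apply/funext => u; apply: autV_funK.
Qed.

Definition autV (g : aut) : aut :=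
  CantorAut (autV_bij g) (autV_hom g) (autV_induced g).

(* The carrier does not depend on hv, but closure under composition does; the
   vacuous let lets inference recover hv from the type. *)
Definition cantor_group : Type := let _ := hv in aut.

HB.instance Definition _ := gen_eqMixin cantor_group.
HB.instance Definition _ := gen_choiceMixin cantor_group.

Fact autMA : associative (autM : cantor_group -> cantor_group -> cantor_group).
Proof. by move=> f g h; apply: aut_eq. Qed.
Fact aut1M : left_id (aut1 : cantor_group) autM.
Proof. by move=> g; apply: aut_eq. Qed.
Fact autM1 : right_id (aut1 : cantor_group) autM.
Proof. by move=> g; apply: aut_eq. Qed.
Fact autVM : left_inverse (aut1 : cantor_group) autV autM.
Proof. by move=> g; apply: aut_eq => u; apply: autV_funVK. Qed.
Fact autMV : right_inverse (aut1 : cantor_group) autV autM.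
Proof. by move=> g; apply: aut_eq => u; apply: autV_funK. Qed.

HB.instance Definition _ :=
  isGroup.Build cantor_group autMA aut1M autM1 autVM autMV.

Definition adm_act (Y : adm S r) (g : cantor_group) : adm S r :=
  Adm (aut_admissible g hv (adm_setP Y)).

Lemma adm_act1 Y : adm_act Y 1%g = Y.
Proof. by apply: adm_eq; rewrite /= image_id. Qed.

Lemma adm_actM Y g h : adm_act Y (g * h)%g = adm_act (adm_act Y g) h.
Proof. by apply: adm_eq; rewrite /= -image_comp. Qed.

Lemma adm_actK g : cancel (adm_act^~ g) (adm_act^~ g^-1%g).
Proof. by move=> Y; rewrite /= -adm_actM mulgV adm_act1. Qed.

Lemma adm_actVK g : cancel (adm_act^~ g^-1%g) (adm_act^~ g).
Proof. by move=> Y; rewrite /= -adm_actM mulVg adm_act1. Qed.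

Lemma adm_act_le Y Z g : adm_le Y Z -> adm_le (adm_act Y g) (adm_act Z g).
Proof.
rewrite /adm_le /=; elim=> [|T T' _ h TT']; first exact: expansion_refl.
apply: expansion_step h _; apply: image_expansion TT'.
  exact: aut_bij.
exact: aut_hom.
Qed.

End CantorGroup.

(* The geometric realisation of a simplicial complex K on V, in barycentric
   coordinates and with the weak topology: a set is open when its trace on
   each closed simplex is open for the (sup) metric of that simplex. *)
Section Realisation.
Local Open Scope ring_scope.
Variables (R : realType) (V : choiceType) (K : set (set V)).

Record realisation := Realisation {
  weight :> V -> R;
  weight_ge0 : forall v, 0 <= weight v;
  weight_supp : K [set v | weight v != 0];
  weight_sum : \sum_(v \in [set: V]) weight v = 1 }.

Definition closed_simplex (s : set V) : set realisation :=
  [set t | [set v | t v != 0] `<=` s].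

Definition realisation_open : set (set realisation) :=
  [set A | forall s, K s -> forall t, A t -> closed_simplex s t ->
    exists2 e : R, 0 < e & forall t', closed_simplex s t' ->
      (forall v, `|t v - t' v| < e) -> A t'].

HB.instance Definition _ := gen_eqMixin realisation.
HB.instance Definition _ := gen_choiceMixin realisation.

Fact realisation_openT : realisation_open setT.
Proof. by move=> s Ks t _ _; exists 1. Qed.

Fact realisation_openI : setI_closed realisation_open.
Proof.
move=> A B oA oB s Ks t [At Bt] st.
have [e e0 he] := oA s Ks t At st; have [d d0 hd] := oB s Ks t Bt st.
exists (Num.min e d); first by rewrite lt_min e0.
move=> t' st' tt'; split; [apply: he|apply: hd] => // v;
  by have := tt' v; rewrite lt_min => /andP[].
Qed.

Fact realisation_open_bigU (I : Type) (f : I -> set realisation) :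
  (forall i, realisation_open (f i)) -> realisation_open (\bigcup_i f i).
Proof.
move=> of_ s Ks t [i _ fit] st; have [e e0 he] := of_ i s Ks t fit st.
by exists e => // t' st' tt'; exists i => //; apply: he.
Qed.

HB.instance Definition _ := isOpenTopological.Build realisation
  realisation_openT realisation_openI realisation_open_bigU.

Lemma realisation_eq (t t' : realisation) : t =1 t' -> t = t'.
Proof.
case: t t' => [t t1 t2 t3] [t' t'1 t'2 t'3] /= /funext e.
rewrite -{}e in t'1 t'2 t'3 *.
by rewrite (Prop_irrelevance t1 t'1) (Prop_irrelevance t2 t'2)
  (Prop_irrelevance t3 t'3).
Qed.

End Realisation.

Definition order_complex (V : Type) (le : V -> V -> Prop) : set (set V) :=
  [set C | [/\ finite_set C, C !=set0 &
    forall x y, C x -> C y -> le x y \/ le y x]].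

Section CantorSpace.
Local Open Scope ring_scope.
Variables (R : realType) (O : signature) (S : laws2 O) (r : nat).
Local Notation V := (adm S r).

Definition adm_space := realisation R (order_complex (@adm_le O S r)).

HB.instance Definition _ := Topological.on adm_space.

Variable hv : valid S r.
Local Notation G := (cantor_group hv).

Section Act.
Variables (t : adm_space) (g : G).
Let w : V -> R := fun Y => t (adm_act Y g^-1%g).

Fact adm_space_act_ge0 Y : 0 <= w Y.
Proof. exact: weight_ge0. Qed.

Fact adm_space_act_supp : order_complex (@adm_le O S r) [set Y | w Y != 0].
Proof.
have [fint [Y0 tY0] chain] := weight_supp t.
split.
- apply: (@sub_finite_set _ _ ((@adm_act O S r hv)^~ g @` [set Y | t Y != 0])).
    by move=> Y wY; exists (adm_act Y g^-1%g) => //; rewrite adm_actVK.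
  exact: finite_image.
- by exists (adm_act Y0 g); rewrite /= /w adm_actK.
- move=> Y Z wY wZ; rewrite -(adm_actVK g Y) -(adm_actVK g Z) /=.
  by case: (chain _ _ wY wZ) => h; [left|right]; apply: adm_act_le.
Qed.

Fact adm_space_act_sum : \sum_(Y \in [set: V]) w Y = 1.
Proof.
rewrite -(weight_sum t).
rewrite [RHS](reindex_fsbigT (fun Y => adm_act Y g^-1%g)) //.
by exists ((@adm_act O S r hv)^~ g); [exact: adm_actVK|exact: adm_actK].
Qed.

(* The affine extension of Y |-> Yg. *)
Definition adm_space_act : adm_space :=
  Realisation adm_space_act_ge0 adm_space_act_supp adm_space_act_sum.

End Act.
End CantorSpace.

Section ProperActions.
Import numFieldNormedType.Exports.
Local Open Scope ring_scope.
Variable R : realType.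

Definition disk n : set 'rV[R]_n := [set x | \sum_i x 0 i ^+ 2 <= 1].
Definition sphere n : set 'rV[R]_n := [set x | \sum_i x 0 i ^+ 2 = 1].
Definition open_disk n : set 'rV[R]_n := [set x | \sum_i x 0 i ^+ 2 < 1].

Definition contractible (T : topologicalType) :=
  exists (x0 : T) (h : T * R -> T),
    [/\ {within [set: T] `*` `[0, 1], continuous h},
        forall x, h (x, 0) = x & forall x, h (x, 1) = x0].

Variable G : groupType.

Definition is_subgroup (H : set G) :=
  [/\ H 1%g, forall g h, H g -> H h -> H (g * h)%g &
      forall g, H g -> H g^-1%g].

Variables (Z : topologicalType) (act : Z -> G -> Z).

Definition is_Gspace :=
  [/\ forall z, act z 1%g = z,
      forall z g h, act z (g * h)%g = act (act z g) h &
      forall g, continuous (act^~ g)].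

(* G is discrete and acts on the right. [skel n] is the (n-1)-skeleton. An element c of [cell n] is an orbit of
   n-cells, attached through the map from (stab c \ G) x D^n to Z sending
   (stab c * g, x) to act (char c x) g. The fields from [char_stab] to
   [char_open] say that the square
       coprod_c (stab c \ G) x S^(n-1)  -->  skel n
                   |                            |
       coprod_c (stab c \ G) x D^n      -->  skel n.+1
   is a pushout of spaces; [char_open] also makes the [char c] continuous. *)
Record GCW_structure := {
  skel : nat -> set Z;
  cell : nat -> Type;
  stab : forall n, cell n -> set G;
  char : forall n, cell n -> 'rV[R]_n -> Z;
  skel0 : skel 0 = set0;
  skelS : forall n, skel n `<=` skel n.+1;
  skel_act : forall n z g, skel n z -> skel n (act z g);
  skel_cover : \bigcup_n skel n = setT;
  skel_open : forall A : set Z,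
    open A <-> forall n, open (A : set (subspace (skel n)));
  stab_subgroup : forall n (c : cell n), is_subgroup (stab c);
  char_stab : forall n (c : cell n) x h,
    disk x -> stab c h -> act (char c x) h = char c x;
  char_disk : forall n (c : cell n) x, disk x -> skel n.+1 (char c x);
  char_sphere : forall n (c : cell n) x, sphere x -> skel n (char c x);
  char_open_disk : forall n (c : cell n) x,
    open_disk x -> ~ skel n (char c x);
  char_surj : forall n z, skel n.+1 z -> ~ skel n z ->
    exists (c : cell n) x g, open_disk x /\ z = act (char c x) g;
  char_inj : forall n (c c' : cell n) x x' g g',
    open_disk x -> open_disk x' -> act (char c x) g = act (char c' x') g' ->
    [/\ c = c', x = x' & stab c (g * g'^-1)%g];
  char_open : forall n (A : set Z),
    open (A : set (subspace (skel n.+1))) <->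
    open (A : set (subspace (skel n))) /\
    forall (c : cell n) g,
      open ([set x | A (act (char c x) g)] : set (subspace (@disk n))) }.

Definition fixed_points (H : set G) : set Z :=
  [set z | forall h, H h -> act z h = z].

Definition is_EG_model :=
  [/\ is_Gspace, inhabited GCW_structure &
      forall H : set G, is_subgroup H ->
        (finite_set H -> contractible (fixed_points H)) /\
        (infinite_set H -> fixed_points H = set0)].

End ProperActions.

(* Main.v *)
(** The poset of admissible sets is directed: following a chain of simple
expansions and contractions from B to C, an upper bound of B and of the current
set survives each step, because two admissible sets above a common one have a
least upper bound.  If H is a finite subgroup and Z is an upper bound of all
B h, then B lies below the whole orbit of Z, whose least upper bound is fixed
by H; so the H-fixed admissible sets are cofinal.  There are countably many
admissible sets, hence an increasing cofinal sequence q_0 <= q_1 <= ... of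
H-fixed ones, and B |-> f B = q_n for the least n with B <= q_n has a chain as
its image, with B <= f B >= q_0.  The homotopies from the identity to f and from f to the
constant q_0 contract the realisation through H-fixed points.

Simple expansions increase the cardinality and automorphisms preserve it, so
a simplex that is mapped to itself is fixed pointwise.  Hence a point fixed by
H has its support fixed vertexwise, which forces H to be finite since an
automorphism is determined by its values on an admissible set; and the orbits
of simplices are the cells of an equivariant CW structure. *)

Require Import Defs.
From HB Require Import structures.
From mathcomp Require Import all_boot all_order all_algebra finmap.
From mathcomp Require Import all_classical all_reals all_analysis.
From mathcomp Require Import ring lra.

Set Implicit Arguments.
Unset Strict Implicit.
Unset Printing Implicit Defensive.

Import Order.TTheory GRing.Theory Num.Theory.
Import numFieldNormedType.Exports.
Local Open Scope classical_set_scope.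

(** * Admissible sets *)

(** A choice structure on the elements makes [fset_set], and with it the numerical cardinality
    [cardf], available for admissible sets. *)
HB.instance Definition _ (O : signature) (A : omega_algebra O) :=
  gen_eqMixin (carrier A).
HB.instance Definition _ (O : signature) (A : omega_algebra O) :=
  gen_choiceMixin (carrier A).

Notation cardf A := #|` fset_set A|.

Lemma fset_set_leq_card (T : choiceType) (A B : set T) :
  finite_set B -> A `<=` B -> (cardf A <= cardf B)%N.
Proof.
move=> finB AB; have finA := sub_finite_set AB finB.
by apply: fsubset_leq_card; rewrite -fset_set_sub.
Qed.

Lemma fset_set_ltn_card (T : choiceType) (A B : set T) x :
  finite_set B -> A `<=` B -> B x -> ~ A x -> (cardf A < cardf B)%N.
Proof.
move=> finB AB Bx nAx; have finA := sub_finite_set AB finB.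
apply: fproper_ltn_card; rewrite fproperE; apply/andP; split.
  by rewrite -fset_set_sub.
by apply/negP; rewrite -fset_set_sub // => /(_ _ Bx).
Qed.

Lemma cardf_image (T T' : choiceType) (f : T -> T') (A : set T) :
  injective f -> finite_set A -> cardf (f @` A) = cardf A.
Proof. by move=> f_inj finA; rewrite fset_set_image // card_imfset. Qed.

Section AdmPoset.
Variables (O : signature) (S : laws2 O) (r : nat).
Local Notation U := (cantor_algebra S r).
Implicit Types (Y Z : set U).

Lemma cantor_reprK (u : U) : cantor_pi S (repr u) = u.
Proof. exact: (reprK (T := term O r)). Qed.

Lemma expansion_trans Y Z (T : set U) :
  expansion Y Z -> expansion Z T -> expansion Y T.
Proof.
by move=> YZ; elim=> // T' T'' _ YT'; apply: expansion_step YT'.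
Qed.

Lemma U_admissible_finite Y : U_admissible Y -> finite_set Y.
Proof.
elim=> {Y} [|Y Z _ IH [i [y [Yy ->]]]|Y Z _ IH [i [a [a_inj aY ->]]]].
- by apply: finite_image; exact: finite_finset.
- rewrite finite_setU; split; first exact: finite_setD.
  by apply: finite_image; exact: finite_finset.
- by rewrite finite_setU; split; [exact: finite_setD|exact: finite_set1].
Qed.

Lemma expansion_admissible Y Z :
  U_admissible Y -> expansion Y Z -> U_admissible Z.
Proof. by move=> admY; elim=> // Z' T _ admZ'; apply: adm_exp. Qed.

Hypothesis hv : valid S r.

(** Arities exceed 1, so [y] has two descendants with different indices. By [U_alp_free] they are
    distinct, and a descendant lying in [Y] can only be [y] itself: one element is removed and at
    least two are added to [Y \ y]. *)
Lemma simple_expansion_card Y Z : U_admissible Y ->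
  simple_expansion Y Z -> (cardf Y < cardf Z)%N.
Proof.
move=> admY YZ; have finY := U_admissible_finite admY.
have finZ := U_admissible_finite (adm_exp admY YZ).
have [i [y [Yy eZ]]] := YZ; have [inj free] := U_alp_free i hv admY Yy.
pose j0 : 'I_(arity i) := Ordinal (ltnW (arity_gt1 i)).
pose j1 : 'I_(arity i) := Ordinal (arity_gt1 i).
have Zj j : Z (alp i j y) by rewrite eZ; right; exists j.
have [j ne_jy] : exists j, alp i j y <> y.
  have [e0|ne0] := pselect (alp i j0 y = y); last by exists j0.
  by exists j1 => e1; have /inj : alp i j0 y = alp i j1 y by rewrite e0 e1.
have [k ne_kj] : exists k, k <> j.
  by have [->|ne] := pselect (j = j0); [exists j1|exists j0 => e; apply: ne].
have ne_kj' : alp i k y <> alp i j y by move=> /inj.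
have finYy : finite_set (Y `\ y) by apply: finite_setD.
(* Y has as many elements as (Y \ y) + alp i j y, which misses alp i k y. *)
have eY : cardf Y = (cardf (Y `\ y)).+1.
  by rewrite (cardfsD1 y) in_fset_set// mem_set// fset_setD1.
have lt1 : (cardf (Y `\ y) < cardf (Y `\ y `|` [set alp i j y]))%N.
  apply: (fset_set_ltn_card (x := alp i j y)).
  - by rewrite finite_setU.
  - by left.
  - by right.
  - by move=> [/free].
rewrite eY; apply: leq_ltn_trans lt1 _.
apply: (fset_set_ltn_card (x := alp i k y)) => //.
  by rewrite eZ; apply: setUS => _ ->; exists j.
move=> [[/free e ne]|//]; exact: ne.
Qed.

Lemma expansion_card Y Z : U_admissible Y -> expansion Y Z ->
  Y = Z \/ (cardf Y < cardf Z)%N.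
Proof.
move=> admY; elim=> [|Z' T YZ' IH Z'T]; first by left.
have lt' := simple_expansion_card (expansion_admissible admY YZ') Z'T.
by right; case: IH => [->//|/ltn_trans]; apply.
Qed.

Implicit Types A B C D : adm S r.

Lemma adm_finite A : finite_set A.
Proof. exact: U_admissible_finite (adm_setP A). Qed.

Lemma adm_le_refl A : adm_le A A.
Proof. exact: expansion_refl. Qed.

Lemma adm_le_trans B A C : adm_le A B -> adm_le B C -> adm_le A C.
Proof. exact: expansion_trans. Qed.

Lemma adm_le_card_eq A B :
  adm_le A B -> (cardf B <= cardf A)%N -> A = B.
Proof.
move=> /(expansion_card (adm_setP A))[/adm_eq //|].
by rewrite ltnNge => /negbTE ->.
Qed.

Lemma adm_le_anti A B : adm_le A B -> adm_le B A -> A = B.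
Proof.
move=> AB /(expansion_card (adm_setP B))[/adm_eq //|lt_BA].
exact: adm_le_card_eq AB (ltnW lt_BA).
Qed.

Local Notation G := (cantor_group hv).

Lemma adm_act_cardf A (g : G) : cardf (adm_act A g) = cardf A.
Proof.
by rewrite cardf_image; [|exact: bij_inj (aut_bij g)|exact: adm_finite].
Qed.

(** Automorphisms preserve the cardinality, while a proper expansion increases it. Every later
    argument that an invariant chain is fixed pointwise rests on this. *)
Lemma adm_act_comparable A (g : G) :
  adm_le A (adm_act A g) \/ adm_le (adm_act A g) A -> adm_act A g = A.
Proof.
by case=> /adm_le_card_eq e; [apply/esym|]; apply: e; rewrite adm_act_cardf.
Qed.

(** Agreement of two homomorphisms passes along simple expansions and contractions, hence from [A]
    to the generators, and from there to all elements by induction on a representing term. *)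
Lemma aut_eq_on A (g h : G) : (forall u, adm_set A u -> g u = h u) -> g = h.
Proof.
move=> eA; apply: aut_eq.
have [g_lam g_alp] := aut_hom g; have [h_lam h_alp] := aut_hom h.
have /(_ _ (U_admissible_reach hv (adm_setP A) (adm_base _))) eX :
    forall Y, admissible A Y -> forall u, Y u -> g u = h u.
  move=> Y; elim=> {Y} [//|Y Z _ IH [i [y [Yy ->]]]|Y Z _ IH [i [a [_ aY ->]]]].
    by move=> u [[/IH]//|[j _ <-]]; rewrite g_alp h_alp IH.
  move=> u [[/IH]//|->]; rewrite g_lam h_lam; congr lam.
  by apply/funext => j; apply/IH/aY; exists j.
have [pi_lam pi_alp] := cantor_pi_hom S r.
move=> u; rewrite -(cantor_reprK u).
elim: (repr u) => [x|i a IH|i j v IH].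
- by apply: eX; exists x.
- rewrite (pi_lam i a) g_lam h_lam; congr lam; exact/funext.
- by rewrite (pi_alp i j v) g_alp h_alp IH.
Qed.

(** An element that fixes [A] maps the finite set [A] to itself and is determined by its values
    there, so there are finitely many such elements. *)
Lemma adm_stab_finite A (H : set G) :
  (forall g, H g -> adm_act A g = A) -> finite_set H.
Proof.
move=> HA; have /finite_seqP[s eA] := adm_finite A.
have HAs g u : H g -> u \in s -> g u \in s.
  move=> /HA/(congr1 (@adm_set _ _ _)) /= egA su.
  have Au : adm_set A u by rewrite eA.
  by have : [set` s] (g u) by rewrite -eA -egA; exists u.
(* The restriction of [g] is recorded by positions in [s]. The target has one index more than [s],
   because [index] returns [size s] on non-members. *)
pose f (g : G) := [ffun i : 'I_(size s) =>
  inord (index (g (tnth (in_tuple s) i)) s) : 'I_(size s).+1].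
apply: (@card_le_finite _ _ H (f @` H)); last exact: finite_finset.
suff /card_esym : (f @` H #= H)%card by rewrite card_eq_le => /andP[].
apply: inj_card_eq => g h /set_mem Hg /set_mem Hh efgh.
apply: (@aut_eq_on A) => u; rewrite eA /= => su.
have lt_us : (index u s < size s)%N by rewrite index_mem.
have := congr1 (fun k : 'I_(size s).+1 => val k)
  (congr1 (fun k : {ffun _ -> _} => k (Ordinal lt_us)) efgh).
have es : tnth (in_tuple s) (Ordinal lt_us) = u.
  by rewrite (tnth_nth u); apply: nth_index.
rewrite !ffunE es /= !inordK ?ltnS ?index_size //.
by move=> e; rewrite -(nth_index u (HAs _ _ Hg su)) e nth_index // HAs.
Qed.

(** * Upper bounds and cofinal chains of fixed admissible sets *)

Hypothesis hb : bounded S r.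

Let X0 : adm S r := Adm (adm_base _).

Lemma adm_directed A B : exists T, adm_le A T /\ adm_le B T.
Proof.
have adm_V : forall Y, admissible A Y ->
    U_admissible Y /\ exists T : adm S r, adm_le A T /\ expansion Y T.
  move=> Y; elim=> {Y}
    [|Y Z _ [admY [T [AT YT]]] YZ|Y Z _ [admY [T [AT YT]]] YZ].
  - by split; [exact: adm_setP|exists A; split; exact: expansion_refl].
  (* Both [T] and [Z] are expansions of [Y], so boundedness supplies a least upper bound of the
     two. *)
  - have admZ := adm_exp admY YZ; split=> //.
    have eYZ := expansion_step (expansion_refl Y) YZ.
    have [T' [[TT' ZT' _] _]] := @hb T (Adm admZ)
      (ex_intro _ (Adm admY) (conj YT eYZ)).
    by exists T'; split=> //; apply: adm_le_trans TT'.
  (* A contraction is undone by an expansion, so [Z] lies below [Y] and the old bound [T] still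
     serves. *)
  - have admZ := adm_con admY YZ; split=> //; exists T; split=> //.
    apply: expansion_trans YT; apply: expansion_step (expansion_refl Z) _.
    exact: U_con_rev YZ.
have [_ [T AT]] := adm_V _ (U_admissible_reach hv (adm_setP A) (adm_setP B)).
by exists T.
Qed.

Lemma adm_directed_seq (I : eqType) (s : seq I) (f : I -> adm S r) :
  exists T, forall i, i \in s -> adm_le (f i) T.
Proof.
elim: s => [|i s [T sT]]; first by exists X0.
have [T' [iT' TT']] := adm_directed (f i) T.
exists T' => j; rewrite inE => /predU1P[->//|/sT jT].
exact: adm_le_trans jT TT'.
Qed.

(** Boundedness yields binary least upper bounds only over a common lower bound. Since [A] stays
    below every partial least upper bound, the next element can always be joined; the head [i0]
    keeps the family nonempty. *)
Lemma adm_lub_seq (I : eqType) i0 (s : seq I) (f : I -> adm S r) A :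
  (forall i, i \in i0 :: s -> adm_le A (f i)) ->
  exists T, (forall i, i \in i0 :: s -> adm_le (f i) T) /\
    forall D, (forall i, i \in i0 :: s -> adm_le (f i) D) -> adm_le T D.
Proof.
elim: s => [|i s IH] Af.
  exists (f i0); split=> [i|D]; last by apply; rewrite mem_head.
  by rewrite inE => /eqP ->; apply: adm_le_refl.
have [|T [sT lubT]] := IH.
  by move=> j js; apply: Af; rewrite !inE orbCA -in_cons js orbT.
have Ai : adm_le A (f i) by apply: Af; rewrite !inE eqxx orbT.
have AT : adm_le A T.
  apply: adm_le_trans (sT i0 (mem_head _ _)); apply: Af; exact: mem_head.
have [T' [[TT' iT' lubT'] _]] := @hb T (f i) (ex_intro _ A (conj AT Ai)).
exists T'; split=> [j|D sD].
  rewrite !inE orbCA => /predU1P[->//|js].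
  by apply: adm_le_trans TT'; apply: sT; rewrite inE.
apply: lubT' => [|]; last by apply: sD; rewrite !inE eqxx orbT.
by apply: lubT => j js; apply: sD; rewrite !inE orbCA -in_cons js orbT.
Qed.

(* If Z is an upper bound of all A h^-1, then A is a common lower bound of the
   orbit of Z, whose least upper bound is fixed by uniqueness. *)
Lemma adm_fixed_cofinal (H : set G) A : is_subgroup H -> finite_set H ->
  exists2 T, adm_le A T & forall h, H h -> adm_act T h = T.
Proof.
move=> [H1 HM HV] /finite_seqP[s eH].
have Hs h : (h \in s) = `[< H h >] by rewrite eH asboolb.
have [Z sZ] := adm_directed_seq s (fun h => adm_act A h^-1%g).
have AZ h : H h -> adm_le A (adm_act Z h).
  move=> Hh; rewrite -[A](adm_actVK h); apply: adm_act_le; apply: sZ.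
  by rewrite Hs; apply/asboolP.
case: s => [|h0 s] in eH Hs sZ *.
  by have := Hs 1%g; rewrite in_nil => /esym/asboolP.
have [|T [sT lubT]] := @adm_lub_seq _ h0 s (adm_act Z) A.
  by move=> h; rewrite Hs => /asboolP/AZ.
(* Writing [k] as [k h^-1 h] with [k h^-1] in [H] shows that the translate of [T] by [h] bounds the
   orbit of [Z] as well. *)
have le_fix h : H h -> adm_le T (adm_act T h).
  move=> Hh; apply: lubT => k; rewrite Hs => /asboolP Hk.
  rewrite -(mulgVK h k) adm_actM; apply: adm_act_le; apply: sT.
  by rewrite Hs; apply/asboolP/HM => //; apply: HV.
exists T; first by apply: adm_le_trans (sT _ (mem_head _ _));
  apply: AZ; rewrite eH /= mem_head.
by move=> h Hh; apply: adm_act_comparable; left; apply: le_fix.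
Qed.

(** Finitely branching trees with labels in [nat] form a countable type. Even node labels mark
    [Lam], odd ones mark [Alp]. *)
Fixpoint term_code (u : term O r) : GenTree.tree nat :=
  match u with
  | Var x => GenTree.Leaf (x : nat)
  | Lam i a => GenTree.Node i.*2 [seq term_code (a j) | j <- enum 'I_(arity i)]
  | Alp i j v => GenTree.Node i.*2.+1 [:: GenTree.Leaf (j : nat); term_code v]
  end.

Lemma term_code_inj : injective term_code.
Proof.
elim=> [x|i a IH|i j v IH] [y|i' a'|i' j' v'] //=.
- by move=> [/val_inj ->].
- move=> [/double_inj/val_inj e]; case: _ / e in a' *.
  move=> /eq_in_map ea; congr Lam; apply/funext => j; apply: IH.
  by apply: ea; rewrite mem_enum.
- by move=> [/(congr1 odd)]; rewrite /= !odd_double.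
- by move=> [/(congr1 odd)]; rewrite /= !odd_double.
- move=> [/double_inj/val_inj e]; case: _ / e in j' *.
  by move=> /val_inj -> /IH ->.
Qed.

Lemma adm_countable : exists c : adm S r -> nat, injective c.
Proof.
have codeP A : exists s : seq (GenTree.tree nat),
    forall u : U, adm_set A u <-> term_code (repr u) \in s.
  have /finite_seqP[s eA] := adm_finite A.
  exists [seq term_code (repr u) | u <- s] => u; rewrite eA /=.
  split=> [us|/(@mapP U)[v vs /term_code_inj/(congr1 (@cantor_pi O S r))]].
    by apply/(@mapP U); exists u.
  move=> e; suff -> : u = v by [].
  exact: etrans (esym (cantor_reprK u)) (etrans e (cantor_reprK v)).
have [c cP] := choice codeP; exists (choice.pickle \o c) => A B /=.
move=> /(pcan_inj choice.pickleK) e.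
by apply: adm_eq; apply/funext => u; apply/propext; rewrite !cP e.
Qed.

Lemma adm_fixed_chain (H : set G) : is_subgroup H -> finite_set H ->
  exists q : nat -> adm S r,
  [/\ forall n h, H h -> adm_act (q n) h = q n,
      forall n, adm_le (q n) (q n.+1) &
      forall A, exists n, adm_le A (q n)].
Proof.
move=> sgH finH; have [c c_inj] := adm_countable.
(* An enumeration of all admissible sets, inverse to the coding [c]; numbers that code nothing are
   sent to [X0]. *)
have [e eP] : exists e : nat -> adm S r, forall A, e (c A) = A.
  have /choice[e eP] : forall n, exists B, forall A, c A = n -> B = A.
    move=> n; have [[B cB]|noB] := pselect (exists A, c A = n).
      by exists B => A cA; apply: c_inj; rewrite cA.
    by exists X0 => A cA; case: noB; exists A.
  by exists e => A; apply: eP.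
have /choice[ub ubP] : forall AB : adm S r * adm S r, exists T : adm S r,
    [/\ adm_le AB.1 T, adm_le AB.2 T & forall h, H h -> adm_act T h = T].
  move=> [A B]; have [T [AT BT]] := adm_directed A B.
  have [T' TT' fixT'] := adm_fixed_cofinal T sgH finH.
  by exists T'; split=> //=; apply: adm_le_trans TT'.
(* The set [q n] is a fixed upper bound of [e n] and of its predecessor in the sequence, so [A] lies
   below [q (c A)]. *)
pose q := nat_rect (fun=> adm S r) (ub (e 0%N, e 0%N))
  (fun n A => ub (A, e n.+1)).
exists q; split=> [[|n]|n|A]; first by case: (ubP (e 0%N, e 0%N)).
- by rewrite /=; case: (ubP (q n, e n.+1)).
- by rewrite /=; case: (ubP (q n, e n.+1)).
exists (c A); rewrite -{1}(eP A); case: (c A) => [|n] /=.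
- by case: (ubP (e 0%N, e 0%N)).
- by case: (ubP (q n, e n.+1)).
Qed.

End AdmPoset.

(** * The weak topology *)

Section RealisationTopology.
Local Open Scope ring_scope.
Variables (R : realType) (V : choiceType) (K : set (set V)).
Local Notation X := (realisation R K).
Implicit Types (t : X) (D : set V).

Definition supp t : set V := [set v | t v != 0].

Lemma supp0 t v : ~ supp t v -> t v = 0.
Proof. by move=> /negP; rewrite negbK => /eqP. Qed.

(* The neighbourhoods of t in the full subcomplex on D, for the sup metric;
   for finite D they determine the weak topology. *)
Definition near_full D t : set_system X := [set A | exists2 e : R, 0 < e &
  forall t', supp t' `<=` D -> (forall v, `|t v - t' v| < e) -> A t'].

Global Instance near_full_filter D t : Filter (near_full D t).
Proof.
split=> [|A B [e e0 eA] [d d0 dB]|A B AB [e e0 eA]].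
- by exists 1.
- exists (Num.min e d); first by rewrite lt_min e0.
  by move=> t' Dt' tt'; split; [apply: eA|apply: dB] => // v;
    have := tt' v; rewrite lt_min => /andP[].
- by exists e => // t' Dt' tt'; apply/AB/eA.
Qed.

Lemma near_full_support D t : \forall t' \near near_full D t, supp t' `<=` D.
Proof. by exists 1. Qed.

Lemma near_full_self D t A : supp t `<=` D -> near_full D t A -> A t.
Proof. by move=> Dt [e e0]; apply=> // v; rewrite subrr normr0. Qed.

Lemma near_full_weight D t v :
  (fun t' : X => t' v) @ near_full D t --> (t v : R^o).
Proof. by apply/cvgrPdist_lt => e e0; exists e. Qed.

(* Each simplex on D is either a coface of the support of t or bounded away
   from t. *)
Lemma near_full_pieces (O : set X) D t : finite_set D ->
  (forall s, K s -> s `<=` D -> supp t `<=` s -> exists2 e : R, 0 < e &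
    forall t', supp t' = s -> (forall v, `|t v - t' v| < e) -> O t') ->
  near_full D t O.
Proof.
move=> finD piece.
have near_piece (s : fpowerset (fset_set D)) : \forall t' \near near_full D t,
    supp t' = [set` val s] -> O t'.
  have sD : [set` val s] `<=` D.
    move=> v /= vs; have := fsvalP s; rewrite fpowersetE => /fsubsetP/(_ _ vs).
    by rewrite in_fset_set // inE.
  have [Ks|nKs] := pselect (K [set` val s]); last first.
    by exists 1 => // t' _ _ et'; case: nKs; rewrite -et'; exact: weight_supp.
  have [ts|/existsNP[v /not_implyP[tv sv]]] :=
    pselect (supp t `<=` [set` val s]).
    have [e e0 eO] := piece _ Ks sD ts.
    by exists e => // t' _ tt' et'; apply: eO.
  exists `|t v|; first by rewrite normr_gt0.
  move=> t' _ /(_ v) + et'.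
  by rewrite [t' v]supp0 ?et' // subr0 ltxx.
apply: filterS (filterI (near_full_support D t) (filter_forall _ near_piece)).
move=> t' [Dt' allO].
have st' : fset_set (supp t') \in fpowerset (fset_set D).
  by rewrite fpowersetE -fset_set_sub //; exact: sub_finite_set finD.
apply: (allO [` st']%fset); rewrite /= fset_setK //.
exact: sub_finite_set finD.
Qed.

Hypothesis K_finite : forall s, K s -> finite_set s.

Lemma supp_finite t : finite_set (supp t).
Proof. exact: K_finite (weight_supp t). Qed.

(** Only finitely many simplices lie on a finite [D], so the radii obtained on single simplices have
    a positive common bound. A moving point may then change its simplex within [D]. *)
Lemma realisation_open_full (O : set X) : open O <->
  forall D t, finite_set D -> O t -> supp t `<=` D -> near_full D t O.
Proof.
have -> : open O = @realisation_open R V K O by [].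
split=> [oO D t finD Ot Dt|nO s Ks t Ot st]; last exact: (nO s t (K_finite Ks)).
apply: near_full_pieces => // s Ks _ st.
have [e e0 eO] := oO _ Ks _ Ot st.
by exists e => // t' et' tt'; apply: eO => //; rewrite /closed_simplex /= -et'.
Qed.

(** A closed simplex is a finite union of open ones, and each of these can be tested separately.
    This suits skeleta, where membership depends only on the number of vertices of the support. *)
Lemma realisation_openP (O : set X) : open O <->
  forall s t, K s -> O t -> supp t `<=` s -> exists2 e : R, 0 < e &
    forall t', supp t' = s -> (forall v, `|t v - t' v| < e) -> O t'.
Proof.
split=> [/realisation_open_full nO s t Ks Ot st|pieces].
  have [e e0 eO] := nO s t (K_finite Ks) Ot st.
  by exists e => // t' et'; apply: eO; rewrite et'.
apply/realisation_open_full => D t finD Ot Dt.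
by apply: near_full_pieces => // s Ks _ st; apply: pieces.
Qed.

(** With all supports in one finite set, closeness in the sup metric is a condition on finitely many
    coordinates. Continuity of maps into the realisation is deduced from this. *)
Lemma cvg_realisation (I : Type) (F : set_system I) (f : I -> X) t D :
  Filter F -> finite_set D -> (\forall i \near F, supp (f i) `<=` D) ->
  supp t `<=` D ->
  (forall v, D v -> (fun i => f i v) @ F --> (t v : R^o)) -> f @ F --> t.
Proof.
move=> FF finD fD tD fv A; rewrite nbhsE => -[W [oW Wt] WA].
have [e e0 eO] := (realisation_open_full W).1 oW D t finD Wt tD.
have near_v (v : fset_set D) : \forall i \near F, `|t (val v) - f i (val v)| < e.
  have Dv : D (val v) by have := fsvalP v; rewrite in_fset_set // inE.
  by have /cvgrPdist_lt/(_ e e0) := fv _ Dv.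
apply: filterS (filterI fD (filter_forall FF near_v)) => i [fiD fiv].
apply/WA/eO => // v; have [Dv|nDv] := pselect (D v).
  have Dv' : v \in fset_set D by rewrite in_fset_set // mem_set.
  exact: (fiv [` Dv']%fset).
by rewrite !supp0 ?subrr ?normr0 //; [move=> /fiD|move=> /tD].
Qed.

Lemma realisation_continuous (T : topologicalType) (f : X -> T) :
  (forall D t, finite_set D -> supp t `<=` D ->
     f @ near_full D t --> f t) -> continuous f.
Proof.
move=> cf; apply/continuousP => O oO; apply/realisation_open_full.
move=> D t finD Oft Dt; apply: (cf D t finD Dt); exact: open_nbhs_nbhs.
Qed.

(* The weak topology is only compatible with products by locally compact
   spaces: for compact J, the set of the t such that {t} x J is mapped into a
   given open set is open by the tube lemma. *)
Lemma realisation_homotopy_continuous (T : topologicalType) (f : X * R -> T) :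
  (forall D t s, finite_set D -> supp t `<=` D ->
     f @ filter_prod (near_full D t) (nbhs s) --> f (t, s)) -> continuous f.
Proof.
move=> cf; have nf (O : set T) D t s : open O -> finite_set D ->
    supp t `<=` D -> O (f (t, s)) ->
    \forall t' \near near_full D t & s' \near s, O (f (t', s')).
  move=> oO finD Dt Of.
  have [PQ nPQ PQO] := cf D t s finD Dt O (open_nbhs_nbhs (conj oO Of)).
  by exists PQ => // -[t' s'] /PQO.
move=> [t s] A; rewrite nbhsE => -[W [oW Wf] WA].
have [[P Q] /= [tP sQ] PQ] :=
  nf W (supp t) t s oW (supp_finite t) (fun=> id) Wf.
have [e /= e0 eQ] := (nbhs_ballP s Q).1 sQ.
(* A compact neighbourhood of [s]: half the radius keeps the closed interval inside the open ball
   contained in [Q]. *)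
pose J := `[s - e / 2, s + e / 2]%classic.
have JQ s' : J s' -> Q s'.
  rewrite /J /= in_itv /= => Js'; apply: eQ; rewrite /ball /= ltr_distlC.
  have e2 : e / 2 < e by rewrite ltr_pdivrMr // mulr_natr mulr2n ltrDl.
  case/andP: Js' => h1 h2; apply/andP; split.
    by apply: lt_le_trans h1; rewrite ltrD2l ltrN2.
  by apply: le_lt_trans h2 _; rewrite ltrD2l.
pose B : set X := [set t' | forall s', J s' -> W (f (t', s'))].
have oB : open B.
  apply/realisation_open_full => D t' finD Bt' Dt'.
  apply: ((compact_near_coveringP J).1 (@segment_compact _ _ _) X
    (near_full D t') (fun t'' s'' => W (f (t'', s'')))) => s' /Bt' Of'.
  have [[P' Q'] /= [tP' sQ'] PQ'] := nf W D t' s' oW finD Dt' Of'.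
  by exists (Q', P') => // -[s1 t1] [Qs Pt]; apply: (PQ' (t1, s1)).
have Bt : B t.
  move=> s' /JQ Qs'; apply: (PQ (t, s')); split=> //=.
  exact: near_full_self tP.
exists (B, J); last by move=> [t' s'] /= [Bt' Js']; apply/WA/Bt'.
split; first exact: open_nbhs_nbhs.
apply/nbhs_ballP; exists (e / 2) => /=; first by rewrite divr_gt0.
move=> s'; rewrite /ball /= ltr_distlC /J /= in_itv /=.
by case/andP => /ltW -> /ltW ->.
Qed.

End RealisationTopology.

(** * Contracting onto a chain *)

Section RealLimits.
Variables (R : realType) (T : Type) (F : set_system T).
Hypothesis FF : Filter F.

Lemma cvg_minr (f g : T -> R) (a b : R) : f @ F --> a -> g @ F --> b ->
  Num.min (f x) (g x) @[x --> F] --> Num.min a b.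
Proof. by apply: continuous2_cvg; exact: min_continuous (a, b). Qed.

Lemma cvg_maxr (f g : T -> R) (a b : R) : f @ F --> a -> g @ F --> b ->
  Num.max (f x) (g x) @[x --> F] --> Num.max a b.
Proof. by apply: continuous2_cvg; exact: max_continuous (a, b). Qed.

Lemma cvg_sumr (I : Type) (s : seq I) (f : I -> T -> R) (l : I -> R) :
  (forall i, f i @ F --> l i) ->
  (fun x => \sum_(i <- s) f i x)%R @ F --> (\sum_(i <- s) l i)%R.
Proof.
move=> fl; apply: (@cvg_big R _ _ 0%R predT (@add_continuous R)) => i _.
exact: fl.
Qed.

Lemma cvg_bigmaxr (I : Type) (s : seq I) (f : I -> T -> R) (l : I -> R) :
  (forall i, f i @ F --> l i) ->
  (fun x => \big[Num.max/0%R]_(i <- s) f i x) @ F -->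
    \big[Num.max/0%R]_(i <- s) l i.
Proof.
move=> fl; apply: (@cvg_big R _ _ 0%R predT (@max_continuous _ R)) => i _.
exact: fl.
Qed.

End RealLimits.

Section Contraction.
Local Open Scope ring_scope.
Variables (R : realType) (V : choiceType) (le : V -> V -> Prop).
Hypothesis le_refl : forall x, le x x.
Hypothesis le_trans : forall y x z, le x y -> le y z -> le x z.
Hypothesis le_anti : forall x y, le x y -> le y x -> x = y.
Local Notation K := (order_complex le).
Local Notation X := (realisation R K).
Implicit Types (t : X) (D : set V).

Lemma order_complex_finite s : K s -> finite_set s.
Proof. by case. Qed.

Local Notation dom t := (fset_set (supp t)).

Lemma dom_finite t : finite_set (supp t).
Proof. exact: (supp_finite order_complex_finite). Qed.

Lemma sum_dom t D (g : V -> R) : finite_set D -> supp t `<=` D ->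
  (forall v, t v = 0 -> g v = 0) ->
  \sum_(v <- dom t) g v = \sum_(v <- fset_set D) g v.
Proof.
move=> finD Dt g0; rewrite -!fsbig_finite //; last exact: dom_finite.
by apply: fsbig_widen => // v [_ ntv]; apply/g0/supp0.
Qed.

Lemma sum_weight t : \sum_(v <- dom t) t v = 1.
Proof.
rewrite -(weight_sum t) -fsbig_finite; last exact: dom_finite.
by apply: fsbig_widen => // v [_ ntv]; apply: supp0.
Qed.

Lemma vertex_support v : K [set w | (v == w)%:R != 0 :> R].
Proof.
rewrite (_ : [set w | _] = [set v]).
  split=> [||_ _ -> ->]; [exact: finite_set1|by exists v|by left].
apply/seteqP; split=> w /=; rewrite pnatr_eq0 eqb0 negbK; first by move/eqP.
by move->.
Qed.

Lemma vertex_sum v : \sum_(w \in [set: V]) ((v == w)%:R : R) = 1.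
Proof.
rewrite -(fsbig_widen [set v]) ?fsbig_set1 ?eqxx //.
by move=> w [_ /= ne_wv]; case: eqVneq => // e; case: ne_wv.
Qed.

Definition vertex v : X :=
  Realisation (fun w => ler0n R (v == w)) (vertex_support v) (vertex_sum v).

(** The upper cumulative distribution function of the probability distribution [t], with the mass at
    [x] included. *)
Definition up t x : R := \sum_(y <- dom t) `[< le x y >]%:R * t y.

Lemma weight_le_up t x : t x <= up t x.
Proof.
have [tx|tx] := eqVneq (t x) 0.
  by rewrite tx; apply: sumr_ge0 => y _; rewrite mulr_ge0 ?ler0n ?weight_ge0.
rewrite /up (big_fsetD1 x) /=; last first.
  by rewrite in_fset_set ?mem_set //; exact: dom_finite.
rewrite asboolT // mul1r lerDl.
by apply: sumr_ge0 => y _; rewrite mulr_ge0 ?ler0n ?weight_ge0.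
Qed.

Lemma up_le1 t x : up t x <= 1.
Proof.
rewrite -(sum_weight t); apply: ler_sum => y _.
by rewrite ler_piMl ?weight_ge0 // lern1 leq_b1.
Qed.

(** Everything above [x] is above [y] by transitivity, and by antisymmetry [y] itself is not above
    [x]. *)
Lemma up_lt t x y : t y != 0 -> le y x -> y <> x -> up t x <= up t y - t y.
Proof.
move=> ty le_yx ne_yx.
have yt : y \in dom t by rewrite in_fset_set ?mem_set //; exact: dom_finite.
rewrite /up !(big_fsetD1 y yt) /= (asboolT (le_refl y)) mul1r addrAC subrr add0r.
rewrite asboolF ?mul0r ?add0r; last by move=> /(le_anti le_yx).
apply: ler_sum => z _; rewrite ler_wpM2r ?weight_ge0 // ler_nat.
by case: asboolP => // /(le_trans le_yx) le_yz; rewrite asboolT.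
Qed.

(* The top part, of mass a, of the distribution t on the chain of its
   support. *)
Definition top_part t a x : R := Num.min a (up t x) - Num.min a (up t x - t x).

Lemma top_part_ge0 t a x : 0 <= top_part t a x.
Proof.
rewrite subr_ge0 le_min ge_min lexx /= ge_min lerBlDr lerDl weight_ge0 orbT.
by [].
Qed.

Lemma top_part_le t a x : top_part t a x <= t x.
Proof.
have tx := weight_ge0 t x; rewrite /top_part /Num.min.
by case: ltP => h1; case: ltP => h2; lra.
Qed.

Lemma top_part0 t x : top_part t 0 x = 0.
Proof.
have := weight_le_up t x; have := weight_ge0 t x.
rewrite /top_part => h1 h2; rewrite !min_l ?subrr //; lra.
Qed.

Lemma top_part1 t x : top_part t 1 x = t x.
Proof.
have := up_le1 t x; have := weight_ge0 t x => h1 h2.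
rewrite /top_part !min_r ?subKr //; lra.
Qed.

Lemma top_part_support t a x : t x = 0 -> top_part t a x = 0.
Proof. by move=> tx; rewrite /top_part tx subr0 subrr. Qed.

(** Counted from the top, the mass at [x] is used up before that at [y] is touched: [a] exceeds
    [up t y - t y], which is at least [up t x] by [up_lt]. *)
Lemma top_part_above t a x y : t y != 0 -> le y x -> y <> x ->
  top_part t a y != 0 -> top_part t a x = t x.
Proof.
move=> ty le_yx ne_yx uy; have le_xy := up_lt ty le_yx ne_yx.
have tx0 := weight_ge0 t x; have ty0 := weight_ge0 t y.
have [le_ay|lt_ya] := leP a (up t y - t y).
  by case/negP: uy; rewrite /top_part !min_l ?subrr //; lra.
by rewrite /top_part !min_r ?subKr //; lra.
Qed.

(** * The two-stage homotopy defined by [f] and [v0] *)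

Variables (f : V -> V) (v0 : V).
Hypothesis f_ge : forall x, le x (f x).
Hypothesis f_chain : forall x y, le (f x) (f y) \/ le (f y) (f x).
Hypothesis v0_le : forall x, le v0 (f x).

Definition clamp (s : R) : R := Num.min 1 (Num.max 0 s).

Lemma clamp_ge0 s : 0 <= clamp s.
Proof. by rewrite /clamp le_min ler01 le_max lexx. Qed.

Lemma clamp_le1 s : clamp s <= 1.
Proof. by rewrite /clamp ge_min lexx. Qed.

Lemma clamp0 s : s <= 0 -> clamp s = 0.
Proof. by move=> s0; rewrite /clamp max_l // min_r. Qed.

Lemma clamp1 s : 1 <= s -> clamp s = 1.
Proof.
move=> s1; rewrite /clamp max_r ?min_l //; lra.
Qed.

(* For s <= 1/2 the top part of mass 2s moves along f; afterwards all of it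
   moves from the image of f to v0. *)
Definition contract_fun t s v : R := \sum_(x <- dom t)
  ((t x - top_part t (clamp (2 * s)) x) * (x == v)%:R
   + (1 - clamp (2 * s - 1)) * top_part t (clamp (2 * s)) x * (f x == v)%:R
   + clamp (2 * s - 1) * top_part t (clamp (2 * s)) x * (v0 == v)%:R).

Definition contract_dom D : set V := D `|` f @` D `|` [set v0].

Lemma contract_dom_finite D : finite_set D -> finite_set (contract_dom D).
Proof.
by move=> finD; rewrite !finite_setU; split=> //; split=> //; exact: finite_image.
Qed.

Lemma contract_ge0 t s v : 0 <= contract_fun t s v.
Proof.
apply: sumr_ge0 => x _; set a := clamp (2 * s).
have u0 := top_part_ge0 t a x; have ut := top_part_le t a x.
have b0 := clamp_ge0 (2 * s - 1); have b1 := clamp_le1 (2 * s - 1).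
by apply: addr_ge0; [apply: addr_ge0|];
  rewrite !mulr_ge0 ?u0 ?ler0n ?subr_ge0.
Qed.

(** Mass arrives at [v0] only when [2 * s - 1] is positive, that is, after the first stage has
    ended. The equation kept in the last case serves to exclude an unmoved point beside [v0]. *)
Lemma contract_neq0 t s v : contract_fun t s v != 0 ->
  exists x, t x != 0 /\
   [\/ v = x /\ top_part t (clamp (2 * s)) x != t x,
       v = f x /\ top_part t (clamp (2 * s)) x != 0 |
       v = v0 /\ clamp (2 * s) = 1].
Proof.
move=> nz; have [x xt] : exists2 x, x \in dom t &
    (t x - top_part t (clamp (2 * s)) x) * (x == v)%:R
   + (1 - clamp (2 * s - 1)) * top_part t (clamp (2 * s)) x * (f x == v)%:R
   + clamp (2 * s - 1) * top_part t (clamp (2 * s)) x * (v0 == v)%:R != 0.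
  apply: contrapT => h; move/eqP: nz; apply; apply: big1_seq => x /= xt.
  by apply: contrapT => /eqP nz; apply: h; exists x.
have tx : t x != 0.
  by move: xt; rewrite in_fset_set ?inE //; exact: dom_finite.
move=> nzx; exists x; split=> //; apply: contrapT => nh; move/eqP: nzx; apply.
have -> : (t x - top_part t (clamp (2 * s)) x) * (x == v)%:R = 0.
  case: eqVneq => [e|_]; rewrite ?mulr0 // mulr1; apply/eqP.
  rewrite subr_eq0 eq_sym; apply/negPn/negP => nt; apply: nh.
  by apply: Or31; split.
have -> : (1 - clamp (2 * s - 1)) * top_part t (clamp (2 * s)) x
    * (f x == v)%:R = 0.
  case: eqVneq => [e|_]; rewrite ?mulr0 // mulr1.
  have [->|nt] := eqVneq (top_part t (clamp (2 * s)) x) 0; first by rewrite mulr0.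
  by case: nh; apply: Or32; split.
case: eqVneq => [e|_]; rewrite ?mulr0 ?addr0 // add0r mulr1.
have [s1|s1] := leP (2 * s) 1; first by rewrite clamp0 ?mul0r //; lra.
by case: nh; apply: Or33; split=> //; apply/clamp1/ltW.
Qed.

Lemma contract_support D t s v : supp t `<=` D ->
  contract_fun t s v != 0 -> contract_dom D v.
Proof.
move=> Dt /contract_neq0[x [tx]].
case=> [[-> _]|[-> _]|[-> _]]; [left; left|left; right|by right].
  exact: Dt.
by exists x => //; apply: Dt.
Qed.

(** Each [x] distributes exactly its mass [t x] among [x], [f x] and [v0], all of which lie in
    [contract_dom D]. *)
Lemma sum_contract D t s : finite_set D -> supp t `<=` D ->
  \sum_(v <- fset_set (contract_dom D)) contract_fun t s v = 1.
Proof.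
move=> finD Dt; have finE := contract_dom_finite finD.
have delta (y : V) (c : R) : contract_dom D y ->
    \sum_(v <- fset_set (contract_dom D)) c * (y == v)%:R = c.
  move=> Ey; rewrite (big_fsetD1 y) /=; last by rewrite in_fset_set ?mem_set.
  rewrite eqxx mulr1 big_seq big1 ?addr0 // => v.
  by rewrite !inE => /andP[/negbTE]; rewrite eq_sym => ->; rewrite mulr0.
rewrite /contract_fun exchange_big /= -[RHS](sum_weight t).
apply: eq_big_seq => x; rewrite in_fset_set ?inE; last exact: dom_finite.
move=> /Dt Dx; rewrite !big_split /= !delta; first by ring.
- by right.
- by left; right; exists x.
- by left; left.
Qed.

Lemma contract_chain t s : K [set v | contract_fun t s v != 0].
Proof.
have finE := contract_dom_finite (dom_finite t).
split.
- apply: sub_finite_set finE => v /=; exact: contract_support.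
- apply: contrapT => nex; have := sum_contract s (dom_finite t) (fun=> id).
  rewrite big1 ?(@eqP _ 0 1) => [/esym/eqP|v _]; first by rewrite oner_eq0.
  by apply: contrapT => /eqP nz; apply: nex; exists v.
have [_ _ chain] := weight_supp t.
(* A moved point below an unmoved one is impossible, and otherwise the image
   of the moved point is above the unmoved one. *)
have above x y : t x != 0 -> t y != 0 -> top_part t (clamp (2 * s)) x != t x ->
    top_part t (clamp (2 * s)) y != 0 -> le x (f y).
  move=> tx ty nx ny; have [->|ne_yx] := pselect (y = x); first exact: f_ge.
  case: (chain _ _ tx ty) => [le_xy|le_yx]; first exact: le_trans (f_ge y).
  by move/eqP: nx; case; apply: top_part_above le_yx ne_yx ny.
(* Two unmoved points are comparable in the support of [t], an unmoved and a moved one by [above],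
   two moved ones by [f_chain]. The point [v0] lies below the image of [f], and no unmoved mass is
   left once it appears. *)
move=> v w /contract_neq0[x [tx vx]] /contract_neq0[y [ty wy]].
case: vx => [[-> nx]|[-> nx]|[-> sx]]; case: wy => [[-> ny]|[-> ny]|[-> sy]] //.
- exact: chain.
- by left; apply: above.
- by move: nx; rewrite sy top_part1 eqxx.
- by right; apply: above.
- by right.
- by move: ny; rewrite sx top_part1 eqxx.
- by left.
- by left.
Qed.

Lemma contract_sum t s : \sum_(v \in [set: V]) contract_fun t s v = 1.
Proof.
rewrite -(sum_contract s (dom_finite t) (fun=> id)) -fsbig_finite; last first.
  exact/contract_dom_finite/dom_finite.
apply/esym/fsbig_widen => // v [_ nv]; apply: contrapT => /eqP nz; apply: nv.
by apply: contract_support nz.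
Qed.

Definition chain_contraction (p : X * R) : X :=
  Realisation (contract_ge0 p.1 p.2) (contract_chain p.1 p.2)
    (contract_sum p.1 p.2).

Lemma chain_contraction_start t : chain_contraction (t, 0) = t.
Proof.
apply: realisation_eq => v; rewrite /= /contract_fun.
rewrite mulr0 sub0r !clamp0 ?lerN10 //.
under eq_bigr do rewrite !top_part0 subr0 !mulr0 !mul0r !addr0.
have [tv|tv] := eqVneq (t v) 0.
  rewrite tv big1 // => x _; have [->|] := eqVneq x v; last by rewrite mulr0.
  by rewrite tv mul0r.
rewrite (big_fsetD1 v) /=; last first.
  by rewrite in_fset_set ?mem_set //; exact: dom_finite.
rewrite eqxx mulr1 big_seq big1 ?addr0 // => x.
by rewrite !inE => /andP[/negbTE -> _]; rewrite mulr0.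
Qed.

Lemma chain_contraction_end t : chain_contraction (t, 1) = vertex v0.
Proof.
apply: realisation_eq => v; rewrite /= /contract_fun !clamp1 //; [|lra|lra].
under eq_bigr do rewrite !top_part1 !subrr !mul0r !add0r mul1r.
by rewrite -mulr_suml sum_weight mul1r.
Qed.

Lemma chain_contraction_continuous : continuous chain_contraction.
Proof.
apply: (realisation_homotopy_continuous order_complex_finite) => D t s finD Dt.
set F := filter_prod _ _; have FF : Filter F by exact: filter_prod_filter.
have nearD : \forall p \near F, supp p.1 `<=` D.
  exists ([set t' | supp t' `<=` D], setT); last by move=> [t' s'] [].
  by split; [exact: near_full_support|exact: filterT].
apply: (cvg_realisation order_complex_finite (D := contract_dom D)).
- exact: contract_dom_finite.
- by apply: filterS nearD => -[t' s'] /= Dt' v; apply: contract_support.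
- by move=> v; apply: contract_support.
move=> v _.
(* The range of summation of [contract_fun] varies with the point. Over the fixed finite set [D] the
   same sum is built from finitely many convergent functions. *)
pose g (p : X * R) := \sum_(x <- fset_set D)
  ((p.1 x - top_part p.1 (clamp (2 * p.2)) x) * (x == v)%:R
   + (1 - clamp (2 * p.2 - 1)) * top_part p.1 (clamp (2 * p.2)) x * (f x == v)%:R
   + clamp (2 * p.2 - 1) * top_part p.1 (clamp (2 * p.2)) x * (v0 == v)%:R).
have eg p : supp p.1 `<=` D -> chain_contraction p v = g p.
  move=> Dp; rewrite /= /contract_fun /g (sum_dom (D := D)) // => x px.
  by rewrite top_part_support // px subrr !(mulr0,mul0r,addr0).
have cw x : (fun p : X * R => p.1 x) @ F --> (t x : R^o).
  apply: (@cvg_comp _ _ _ (@fst X R) (fun t' : X => t' x) F (near_full D t)).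
    exact: cvg_fst.
  exact: near_full_weight.
have cs : (fun p : X * R => p.2) @ F --> (s : R^o) by exact: cvg_snd.
have near_eq (g1 g2 : X * R -> R^o) (l : R^o) :
    (forall p, supp p.1 `<=` D -> g1 p = g2 p) -> g2 @ F --> l -> g1 @ F --> l.
  move=> e12; apply: cvg_trans; apply: near_eq_cvg.
  by apply: filterS nearD => p Dp; rewrite e12.
have cup x : (fun p : X * R => up p.1 x) @ F --> (up t x : R^o).
  apply: (near_eq _ (fun p => \sum_(y <- fset_set D) `[< le x y >]%:R * p.1 y)).
    by move=> p Dp; apply: sum_dom => // y ->; rewrite mulr0.
  rewrite [X in _ --> X](sum_dom (D := D)) => [|//|//|y ->]; last first.
    by rewrite mulr0.
  apply: cvg_sumr => y.
  by apply: cvgMr.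
have cclamp (h : X * R -> R^o) (l : R^o) :
    h @ F --> l -> (fun p => clamp (h p)) @ F --> (clamp l : R^o).
  move=> hl; apply: cvg_minr; first exact: cvg_cst.
  by apply: cvg_maxr; first exact: cvg_cst.
have ca : (fun p : X * R => clamp (2 * p.2)) @ F --> (clamp (2 * s) : R^o).
  by apply: cclamp; apply: cvgM; [exact: cvg_cst|].
have cb : (fun p : X * R => clamp (2 * p.2 - 1)) @ F -->
    (clamp (2 * s - 1) : R^o).
  by apply: cclamp; apply: cvgB; [apply: cvgM; [exact: cvg_cst|]|exact: cvg_cst].
have ctop x : (fun p : X * R => top_part p.1 (clamp (2 * p.2)) x) @ F -->
    (top_part t (clamp (2 * s)) x : R^o).
  by apply: cvgB; apply: cvg_minr => //; apply: cvgB.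
apply: (near_eq _ g) => [p /eg //|].
rewrite [X in _ --> X](eg (t, s)) //.
apply: cvg_sumr => x.
apply: cvgD; last by apply: cvgM; [exact: cvgM|exact: cvg_cst].
apply: cvgD; first by apply: cvgM; [exact: cvgB|exact: cvg_cst].
apply: cvgM; last exact: cvg_cst.
by apply: cvgM => //; apply: cvgB => //; exact: cvg_cst.
Qed.

End Contraction.

(** * Disks and simplices *)

Lemma cvg_rowvec (R : realType) n (T : Type) (F : set_system T)
    (f : T -> 'rV[R]_n) (l : 'rV[R]_n) : Filter F ->
  (forall j, (fun t => f t 0%R j) @ F --> (l 0%R j : R^o)) -> f @ F --> l.
Proof.
move=> FF fl A [P nP PA].
have near_j j : \forall t \near F, P 0%R j (f t 0%R j) by exact: fl (nP 0%R j).
apply: filterS (filter_forall FF near_j) => t Pt; apply: PA => i j.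
by rewrite (ord1 i).
Qed.

Section SimplexDisk.
Local Open Scope ring_scope.
Variables (R : realType) (n : nat).
Implicit Types (x y : 'rV[R]_n) (i : 'I_n.+1).

(** The linear isomorphism from n-space onto the hyperplane of vectors with n + 1 coordinates of sum
    zero. *)
Definition lin x i : R :=
  if unlift ord_max i is Some j then x 0 j else - \sum_j x 0 j.

Lemma lin_lift x j : lin x (lift ord_max j) = x 0 j.
Proof. by rewrite /lin liftK. Qed.

Lemma sum_ord_lift (F : 'I_n.+1 -> R) :
  \sum_i F i = \sum_j F (lift ord_max j) + F ord_max.
Proof.
rewrite big_ord_recr; congr (_ + _); apply: eq_bigr => j _; congr F.
by apply: val_inj; rewrite /= /bump leqNgt ltn_ord.
Qed.

Lemma sum_lin x : \sum_i lin x i = 0.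
Proof.
rewrite sum_ord_lift {2}/lin unlift_none.
under eq_bigr do rewrite lin_lift; exact: subrr.
Qed.

Lemma linZ c x i : lin (c *: x) i = c * lin x i.
Proof.
rewrite /lin; case: unliftP => [j _|_]; first by rewrite mxE.
by rewrite mulrN mulr_sumr; congr (- _); apply: eq_bigr => j _; rewrite mxE.
Qed.

Lemma lin_inj x y : lin x =1 lin y -> x = y.
Proof. by move=> e; apply/rowP => j; rewrite -!lin_lift. Qed.

Definition enorm x : R := Num.sqrt (\sum_j x 0 j ^+ 2).

Lemma enorm_sqr x : enorm x ^+ 2 = \sum_j x 0 j ^+ 2.
Proof. by rewrite sqr_sqrtr // sumr_ge0 // => j _; apply: sqr_ge0. Qed.

Lemma enorm_ge0 x : 0 <= enorm x. Proof. exact: sqrtr_ge0. Qed.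

Lemma enorm_eq0 x : (enorm x == 0) = (x == 0).
Proof.
rewrite sqrtr_eq0 le_eqVlt ltNge sumr_ge0 /=; last by move=> j _; apply: sqr_ge0.
rewrite orbF; apply/eqP/eqP => [/psumr_eq0P e|->].
  apply/rowP => j; rewrite mxE; apply/eqP; rewrite -sqrf_eq0; apply/eqP/e => //.
  by move=> k _; apply: sqr_ge0.
by apply: big1 => j _; rewrite mxE expr0n.
Qed.

Lemma enormZ c x : enorm (c *: x) = `|c| * enorm x.
Proof.
rewrite -sqrtr_sqr -sqrtrM ?sqr_ge0 // mulr_sumr; congr Num.sqrt.
by apply: eq_bigr => j _; rewrite mxE exprMn.
Qed.

Lemma coord_le_enorm x j : `|x 0 j| <= enorm x.
Proof.
rewrite -sqrtr_sqr; apply: ler_wsqrtr; rewrite (bigD1 j) //= lerDl.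
by apply: sumr_ge0 => k _; apply: sqr_ge0.
Qed.

(* The gauge of the simplex with barycentric coordinates
   (1 + lin x i) / (n + 1). *)
Definition gauge x : R := \big[Num.max/0]_i (- lin x i).

Lemma gauge_ge0 x : 0 <= gauge x. Proof. exact: bigmax_ge_id. Qed.

Lemma lin_ge_gauge x i : - lin x i <= gauge x.
Proof. exact: le_bigmax. Qed.

Lemma gaugeZ c x : 0 <= c -> gauge (c *: x) = c * gauge x.
Proof.
move=> c0; rewrite /gauge.
under eq_bigr do rewrite linZ -mulrN.
rewrite -[X in \big[_/X]_(_ <- _) _](mulr0 c).
by elim/big_rec2: _ => // i a b _ ->; rewrite maxr_pMr.
Qed.

(** The coordinates sum to zero, so each is minus the sum of the others, and each of those
    contributes at most [gauge x]. *)
Lemma lin_le_gauge x i : `|lin x i| <= n.+1%:R * gauge x.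
Proof.
have g0 := gauge_ge0 x; rewrite ler_norml; apply/andP; split.
  rewrite lerNl (le_trans (lin_ge_gauge x i)) // ler_peMl //.
  by rewrite ler1n.
have /eqP := sum_lin x; rewrite (bigD1 i) //= addr_eq0 => /eqP ->.
rewrite -sumrN mulr_natl -[n.+1 in leRHS](card_ord n.+1) -sumr_const.
rewrite [leRHS](bigD1 i) //= -[leLHS]add0r; apply: lerD => //.
by apply: ler_sum => k _; apply: lin_ge_gauge.
Qed.

Lemma gauge_eq0 x : (gauge x == 0) = (x == 0).
Proof.
apply/eqP/eqP => [g0|->]; last by rewrite -(scale0r 0) gaugeZ ?mul0r.
apply: lin_inj => i; rewrite -(scale0r 0) linZ mul0r; apply/eqP.
by rewrite -normr_le0 (le_trans (lin_le_gauge x i)) // g0 mulr0.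
Qed.

Lemma gauge_attained x : 0 < gauge x -> exists i, - lin x i = gauge x.
Proof.
move=> g0; apply: contrapT => ne.
suff : gauge x < gauge x by rewrite ltxx.
apply/bigmax_ltP; split=> // i _; rewrite lt_neqAle lin_ge_gauge andbT.
by apply/eqP => e; apply: ne; exists i.
Qed.

(* Both maps rescale rays, exchanging the unit balls of enorm and gauge; the
   maximum extends to_simplex outside the disk with values in the simplex. *)
Definition to_simplex x : 'rV[R]_n :=
  (enorm x / (gauge x * Num.max 1 (enorm x))) *: x.

Definition to_disk y : 'rV[R]_n := (gauge y / enorm y) *: y.

Lemma max1_gt0 (a : R) : 0 < Num.max 1 a.
Proof. by rewrite lt_max ltr01. Qed.

Lemma gauge_to_simplex x : gauge (to_simplex x) = enorm x / Num.max 1 (enorm x).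
Proof.
rewrite gaugeZ; last by rewrite mulr_ge0 ?enorm_ge0 // invr_ge0 mulr_ge0
  ?gauge_ge0 // ltW // max1_gt0.
have [->|x0] := eqVneq x 0.
  have -> : gauge 0 = 0 by apply/eqP; rewrite gauge_eq0.
  by have -> : enorm 0 = 0 by [apply/eqP; rewrite enorm_eq0]; rewrite mulr0 mul0r.
have g0 : gauge x != 0 by rewrite gauge_eq0.
by rewrite invfM mulrA mulrAC divfK.
Qed.

Lemma gauge_to_simplex_disk x : enorm x <= 1 -> gauge (to_simplex x) = enorm x.
Proof. by move=> x1; rewrite gauge_to_simplex max_l // divr1. Qed.

Lemma enorm_to_disk y : enorm (to_disk y) = gauge y.
Proof.
have [->|y0] := eqVneq y 0.
  rewrite /to_disk scaler0; have -> : gauge 0 = 0 by apply/eqP; rewrite gauge_eq0.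
  by apply/eqP; rewrite enorm_eq0.
have e0 : enorm y != 0 by rewrite enorm_eq0.
by rewrite enormZ ger0_norm ?divr_ge0 ?gauge_ge0 ?enorm_ge0 // divfK.
Qed.

Lemma to_diskK y : gauge y <= 1 -> to_simplex (to_disk y) = y.
Proof.
move=> y1; have [->|y0] := eqVneq y 0.
  by rewrite /to_disk /to_simplex !scaler0.
have e0 : enorm y != 0 by rewrite enorm_eq0.
have g0 : gauge y != 0 by rewrite gauge_eq0.
rewrite /to_simplex enorm_to_disk max_l // {2}/to_disk scalerA.
rewrite gaugeZ ?divr_ge0 ?gauge_ge0 ?enorm_ge0 //.
by rewrite -[RHS]scale1r; congr (_ *: _); field; rewrite g0 e0.
Qed.

Lemma to_simplexK x : enorm x <= 1 -> to_disk (to_simplex x) = x.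
Proof.
move=> x1; have [->|x0] := eqVneq x 0.
  by rewrite /to_disk /to_simplex !scaler0.
have e0 : enorm x != 0 by rewrite enorm_eq0.
have g0 : gauge x != 0 by rewrite gauge_eq0.
rewrite /to_disk gauge_to_simplex_disk // {2}/to_simplex scalerA max_l // mulr1.
rewrite enormZ ger0_norm; last first.
  by rewrite divr_ge0 ?mulr_ge0 ?gauge_ge0 ?enorm_ge0 // ltW ?max1_gt0.
rewrite max_l // mulr1 -[RHS]scale1r; congr (_ *: _); field.
by rewrite g0 e0.
Qed.

Section Limits.
Variables (T : Type) (F : set_system T) (f : T -> 'rV[R]_n) (l : 'rV[R]_n).
Hypothesis FF : Filter F.
Hypothesis fl : forall j, (fun t => f t 0 j) @ F --> (l 0 j : R^o).

Lemma cvg_lin i : (fun t => lin (f t) i) @ F --> (lin l i : R^o).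
Proof.
rewrite /lin; case: unliftP => [j _|_] /=; first exact: fl.
by apply: cvgN; apply: cvg_sumr.
Qed.

Lemma cvg_enorm : (fun t => enorm (f t)) @ F --> (enorm l : R^o).
Proof.
apply: (continuous_cvg FF (f := fun t => \sum_j f t 0 j ^+ 2) (h := Num.sqrt)).
  exact: sqrt_continuous.
by apply: cvg_sumr => j; apply: cvgM.
Qed.

Lemma cvg_gauge : (fun t => gauge (f t)) @ F --> (gauge l : R^o).
Proof. by apply: cvg_bigmaxr => i; apply: cvgN; apply: cvg_lin. Qed.

Lemma cvg_lin_to_simplex i :
  (fun t => lin (to_simplex (f t)) i) @ F --> (lin (to_simplex l) i : R^o).
Proof.
have [l0|l0] := eqVneq l 0; last first.
  rewrite linZ; under eq_fun do rewrite linZ.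
  apply: cvgM; last exact: cvg_lin.
  apply: cvgM; first exact: cvg_enorm.
  apply: cvgV; first by rewrite mulf_neq0 ?gauge_eq0 // gt_eqF ?max1_gt0.
  apply: cvgM; first exact: cvg_gauge.
  by apply: cvg_maxr; [exact: cvg_cst|exact: cvg_enorm].
have -> : lin (to_simplex l) i = 0.
  by rewrite l0 linZ -(scale0r 0) linZ mul0r mulr0.
apply/norm_cvg0P.
(* At the origin the denominator of the scaling factor vanishes, so the limit comes from a squeeze:
   the gauge of the image is at most [enorm]. *)
apply: (@squeeze_cvgr _ _ _ _ (fun=> 0) (fun t => n.+1%:R * enorm (f t))).
- apply: nearW => t; rewrite normr_ge0 /= (le_trans (lin_le_gauge _ _)) //.
  rewrite ler_wpM2l ?ler0n // gauge_to_simplex ler_pdivrMr ?max1_gt0 //.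
  by rewrite ler_peMr ?enorm_ge0 // le_max lexx.
- exact: cvg_cst.
- have e0 : enorm l = 0 by apply/eqP; rewrite enorm_eq0 l0.
  rewrite -[X in _ --> X](mulr0 n.+1%:R) -[X in _ * X]e0.
  by apply: cvgM; [exact: cvg_cst|exact: cvg_enorm].
Qed.

Lemma cvg_to_disk : (fun t => to_disk (f t)) @ F --> to_disk l.
Proof.
apply: cvg_rowvec => j; have [l0|l0] := eqVneq l 0; last first.
  rewrite mxE; under eq_fun do rewrite mxE.
  apply: cvgM; last exact: fl.
  apply: cvgM; first exact: cvg_gauge.
  by apply: cvgV; [rewrite enorm_eq0|exact: cvg_enorm].
have -> : to_disk l 0 j = 0 by rewrite l0 /to_disk scaler0 mxE.
(* The scaling factor again degenerates at the origin; the image has norm [gauge], which tends to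
   zero. *)
apply/norm_cvg0P.
apply: (@squeeze_cvgr _ _ _ _ (fun=> 0) (fun t => gauge (f t))).
- by apply: nearW => t; rewrite normr_ge0 /= -enorm_to_disk coord_le_enorm.
- exact: cvg_cst.
- have g0 : gauge l = 0 by apply/eqP; rewrite gauge_eq0 l0.
  by rewrite -[X in _ --> X]g0; exact: cvg_gauge.
Qed.

End Limits.

(** * Barycentric coordinates on the disk *)

Definition bary x i : R := (1 + lin (to_simplex x) i) / n.+1%:R.

Definition unbary (w : 'I_n.+1 -> R) : 'rV[R]_n :=
  to_disk (\row_j (n.+1%:R * w (lift ord_max j) - 1)).

Lemma enorm_disk x : disk x <-> enorm x <= 1.
Proof.
by rewrite /disk /= -enorm_sqr expr_le1 ?enorm_ge0.
Qed.

Lemma enorm_open_disk x : open_disk x <-> enorm x < 1.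
Proof. by rewrite /open_disk /= -enorm_sqr expr_lt1 ?enorm_ge0. Qed.

Lemma enorm_sphere x : sphere x -> enorm x = 1.
Proof. by rewrite /sphere /= /enorm => ->; rewrite sqrtr1. Qed.

Lemma open_disk_sub x : open_disk x -> disk x.
Proof. exact: ltW. Qed.

Lemma bary_ge0 x i : 0 <= bary x i.
Proof.
rewrite divr_ge0 // -lerBlDl sub0r lerNl (le_trans (lin_ge_gauge _ _)) //.
by rewrite gauge_to_simplex ler_pdivrMr ?max1_gt0 // mul1r le_max lexx orbT.
Qed.

Lemma bary_sum x : \sum_i bary x i = 1.
Proof.
rewrite -mulr_suml big_split /= sum_lin addr0 sumr_const card_ord.
by rewrite -mulr_natl mulr1 divff // gt_eqF.
Qed.

Lemma bary_gt0 x i : open_disk x -> 0 < bary x i.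
Proof.
move=> /enorm_open_disk x1; rewrite divr_gt0 // -ltrBlDl sub0r ltrNl.
by rewrite (le_lt_trans (lin_ge_gauge _ _)) // gauge_to_simplex_disk // ltW.
Qed.

(** The image of a unit vector has gauge 1. A coordinate at which this maximum is attained has [lin]
    equal to -1, and its barycentric coordinate vanishes. *)
Lemma bary_sphere x : sphere x -> exists i, bary x i = 0.
Proof.
move=> /enorm_sphere x1; have g1 : gauge (to_simplex x) = 1.
  by rewrite gauge_to_simplex_disk x1.
have [|i ei] := @gauge_attained (to_simplex x); first by rewrite g1.
exists i; rewrite /bary (_ : 1 + _ = 0) ?mul0r //.
by rewrite -[lin _ _]opprK ei g1 subrr.
Qed.

Lemma unbaryK (w : 'I_n.+1 -> R) : (forall i, 0 <= w i) -> \sum_i w i = 1 ->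
  disk (unbary w) /\ bary (unbary w) =1 w.
Proof.
move=> w0 w1.
pose y : 'rV[R]_n := \row_j (n.+1%:R * w (lift ord_max j) - 1).
have ey i : lin y i = n.+1%:R * w i - 1.
  have [j ->|->] := unliftP ord_max i; first by rewrite lin_lift mxE.
  rewrite /lin unlift_none; under eq_bigr do rewrite mxE.
  rewrite sumrB sumr_const card_ord -mulr_sumr.
  move: w1; rewrite sum_ord_lift => /(canRL (addrK _)) ->.
  by rewrite -[in n.+1%:R]addn1 natrD; ring.
have y1 : gauge y <= 1.
  apply: bigmax_le => // i _; rewrite ey opprB lerBlDr lerDl.
  by rewrite mulr_ge0 // ltW.
rewrite /unbary -/y; split=> [|i].
  by apply/enorm_disk; rewrite enorm_to_disk.
by rewrite /bary to_diskK // ey addrC subrK mulrC mulKf // gt_eqF.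
Qed.

(** If the norm were 1, [bary_sphere] would make one of the weights vanish. *)
Lemma unbary_open_disk (w : 'I_n.+1 -> R) :
  (forall i, 0 < w i) -> \sum_i w i = 1 -> open_disk (unbary w).
Proof.
move=> w0 w1; have [dw ew] := unbaryK (fun i => ltW (w0 i)) w1.
apply/enorm_open_disk; rewrite lt_neqAle (enorm_disk _).1 // andbT.
apply/eqP => e1; have [|i] := @bary_sphere (unbary w).
  by rewrite /sphere /= -enorm_sqr e1 expr1n.
by rewrite ew => wi; have := w0 i; rewrite wi ltxx.
Qed.

Lemma baryK x : disk x -> unbary (bary x) = x.
Proof.
move=> /enorm_disk x1; rewrite /unbary (_ : \row_j _ = to_simplex x).
  exact: to_simplexK.
apply/rowP => j; rewrite mxE /bary lin_lift mulrC divfK ?gt_eqF //.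
by rewrite addrC addKr.
Qed.

Lemma cvg_bary (T : Type) (F : set_system T)
    (f : T -> 'rV[R]_n) (l : 'rV[R]_n) i :
  Filter F -> (forall j, (fun t => f t 0 j) @ F --> (l 0 j : R^o)) ->
  (fun t => bary (f t) i) @ F --> (bary l i : R^o).
Proof.
move=> FF fl; apply: cvgM; last exact: cvg_cst.
by apply: cvgD; [exact: cvg_cst|exact: cvg_lin_to_simplex].
Qed.

Lemma bary_continuous i : continuous (fun x => bary x i : R^o).
Proof.
by move=> x; apply: (@cvg_bary _ (nbhs x) id x i) => j; exact: coord_continuous.
Qed.

Lemma cvg_unbary (T : Type) (F : set_system T) (w : T -> 'I_n.+1 -> R)
    (l : 'I_n.+1 -> R) : Filter F ->
  (forall i, (fun t => w t i) @ F --> (l i : R^o)) ->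
  (fun t => unbary (w t)) @ F --> unbary l.
Proof.
move=> FF wl; apply: cvg_to_disk => j; rewrite mxE; under eq_fun do rewrite mxE.
by apply: cvgB; [apply: cvgM; [exact: cvg_cst|]|exact: cvg_cst].
Qed.

End SimplexDisk.

(** * The action and its fixed points *)

Section AdmSpace.
Local Open Scope ring_scope.
Variables (R : realType) (O : signature) (S : laws2 O) (r : nat).
Hypothesis hv : valid S r.
Local Notation V := (adm S r).
Local Notation le := (@adm_le O S r).
Local Notation X := (adm_space R S r).
Local Notation G := (cantor_group hv).
Local Notation act := (@adm_space_act R O S r hv).
Local Notation K := (order_complex le).
Local Notation act_adm := (@adm_act O S r hv).

Lemma adm_act_inj g : injective (act_adm^~ g).
Proof. exact: can_inj (adm_actK g). Qed.

Lemma supp_act (z : X) g : supp (act z g) = act_adm^~ g @` supp z.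
Proof.
apply/seteqP; split=> [Y zY|_ [Y zY <-]].
  by exists (adm_act Y g^-1%g) => //; rewrite adm_actVK.
by rewrite /supp /= adm_actK.
Qed.

Lemma adm_space_act_continuous g : continuous (act^~ g : X -> X).
Proof.
apply: (realisation_continuous (@order_complex_finite _ le)) => D t finD Dt.
apply: (cvg_realisation (@order_complex_finite _ le) (D := act_adm^~ g @` D)).
- exact: finite_image.
- apply: filterS (near_full_support D t) => t' Dt'.
  by rewrite supp_act; apply: image_subset.
- by rewrite supp_act; apply: image_subset.
- move=> v _ /=; exact: near_full_weight.
Qed.

Lemma adm_space_Gspace : is_Gspace (Z := X) act.
Proof.
split=> [z|z g h|g]; last exact: adm_space_act_continuous.
  by apply: realisation_eq => Y; rewrite /= invg1 adm_act1.
by apply: realisation_eq => Y; rewrite /= invgM adm_actM.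
Qed.

Lemma chain_act_fixed s (g : G) : K s ->
  (forall Y, s Y -> s (adm_act Y g)) -> forall Y, s Y -> adm_act Y g = Y.
Proof.
move=> [_ _ chain] sg Y sY; apply: adm_act_comparable.
exact: chain sY (sg Y sY).
Qed.

(** A group element fixing [z] maps the support of [z] to itself, and by [chain_act_fixed] it can
    move no element of this chain. *)
Lemma act_fixedP (z : X) g :
  act z g = z <-> forall Y, supp z Y -> adm_act Y g = Y.
Proof.
split=> [zg|fix_z].
  apply: chain_act_fixed (weight_supp z) _ => Y zY.
  by have : supp (act z g) (adm_act Y g); [rewrite supp_act; exists Y|rewrite zg].
apply: realisation_eq => Y /=; have [zY|zY] := pselect (supp z Y).
  by rewrite -{1}(fix_z Y zY) adm_actK.
have [zYg|zYg] := pselect (supp z (adm_act Y g^-1%g)).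
  by case: zY; rewrite -(adm_actVK g Y) fix_z.
by rewrite !supp0.
Qed.

Lemma fixed_points_infinite (H : set G) : infinite_set H ->
  fixed_points (Z := X) act H = set0.
Proof.
move=> infH; apply/seteqP; split=> // z fix_z; case: infH.
have [_ [Y zY] _] := weight_supp z; apply: (adm_stab_finite (A := Y)) => g Hg.
by have /act_fixedP/(_ Y zY) := fix_z g Hg.
Qed.

Hypothesis hb : bounded S r.

Lemma fixed_points_contractible (H : set G) : is_subgroup H -> finite_set H ->
  contractible R (fixed_points (Z := X) act H).
Proof.
move=> sgH finH; have [q [q_fix q_le q_cof]] := adm_fixed_chain hb sgH finH.
have q_mono m n : (m <= n)%N -> le (q m) (q n).
  elim: n => [|n IH]; first by rewrite leqn0 => /eqP ->; apply: adm_le_refl.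
  rewrite leq_eqVlt => /predU1P[->|/IH]; first exact: adm_le_refl.
  move=> le_mn; exact: adm_le_trans (q_le n).
have q_cofb A : exists n, `[< le A (q n) >].
  by have [n An] := q_cof A; exists n; apply/asboolP.
pose N A := ex_minn (q_cofb A); pose f A := q (N A).
have f_ge A : le A (f A) by rewrite /f /N; case: ex_minnP => n /asboolP.
have f_chain A B : le (f A) (f B) \/ le (f B) (f A).
  by case: (leqP (N A) (N B)) => [|/ltnW] /q_mono; [left|right].
have f_q0 A : le (q 0) (f A) by apply: q_mono.
pose h := @chain_contraction R V le (@adm_le_refl O S r)
  (@adm_le_trans O S r) (adm_le_anti hv) f (q 0) f_ge f_chain f_q0.
pose T : topologicalType := fixed_points (Z := X) act H.
(* At every time the support consists of elements of the support of [z], values of [f] and [q 0];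
   the last two kinds are members of the fixed sequence [q]. *)
have h_fix z s : fixed_points (Z := X) act H z ->
    fixed_points (Z := X) act H (h (z, s)).
  move=> fix_z g Hg; apply/act_fixedP => Y /contract_neq0[A [zA]].
  case=> [[-> _]|[-> _]|[-> _]]; [|exact: q_fix|exact: q_fix].
  by have /act_fixedP := fix_z g Hg; apply.
have v_fix : fixed_points (Z := X) act H (vertex R (@adm_le_refl O S r) (q 0)).
  move=> g Hg; apply/act_fixedP => Y; rewrite /supp /=.
  by rewrite pnatr_eq0 eqb0 negbK => /eqP <-; apply: q_fix.
pose hT (p : T * R) : T := exist _ (h (\val p.1, p.2))
  (mem_set (h_fix (\val p.1) p.2 (set_valP p.1))).
pose x0 : T := exist (fun x : X => x \in fixed_points (Z := X) act H) _
  (mem_set v_fix).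
exists x0, hT; split.
(* The homotopy is continuous for all real times. The fixed point set carries the initial topology
   of its inclusion, so continuity is checked in the whole realisation. *)
- apply: continuous_subspaceT; apply: continuous_comp_initial.
  have -> : set_val \o hT = h \o (fun p => (set_val p.1, p.2)).
    by apply/funext.
  move=> p; apply: continuous_comp; last exact: chain_contraction_continuous.
  have c1 : (fun p' : T * R => set_val p'.1 : X) @ p --> (set_val p.1 : X).
    apply: (@continuous_comp _ _ _ (@fst T R) (@set_val X _)).
      exact: cvg_fst.
    exact: initial_continuous.
  have c2 : (fun p' : T * R => p'.2) @ p --> p.2 by exact: cvg_snd.
  exact: (cvg_pair c1 c2).
- by move=> x; apply: val_inj; apply: chain_contraction_start.
- by move=> x; apply: val_inj; apply: chain_contraction_end.
Qed.
End AdmSpace.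

(** * The cell structure *)

Lemma fsum_range (R : realType) (V : choiceType) m (e : 'I_m -> V) (F : V -> R) :
  injective e -> (forall v, ~ range e v -> F v = 0%R) ->
  (\sum_(v \in [set: V]) F v = \sum_i F (e i))%R.
Proof.
move=> e_inj F0; rewrite -(fsbig_widen (range e)) //; last first.
  by move=> v [_ /F0].
rewrite (reindex_fsbig e [set: 'I_m]); last by apply: inj_bij => i j _ _ /e_inj.
rewrite (fsbig_fwiden (index_enum 'I_m)) // ?index_enum_uniq //.
- by move=> i _ /=; rewrite mem_index_enum.
- by move=> i [_ []].
Qed.

Lemma finite_set_enum (V : choiceType) (C : set V) m : finite_set C ->
  cardf C = m.+1 -> exists e : 'I_m.+1 -> V, injective e /\ range e = C.
Proof.
move=> finC cardC; have lt_size (i : 'I_m.+1) : (i < size (fset_set C))%N.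
  by rewrite cardC.
have /fset0Pn[v0 _] : fset_set C != fset0 by rewrite -cardfs_gt0 cardC.
exists (fun i => nth v0 (fset_set C) i); split=> [i j /eqP|].
  by rewrite nth_uniq ?fset_uniq ?lt_size // => /eqP/val_inj.
apply/seteqP; split=> [_ [i _ <-]|v Cv].
  by apply/set_mem; rewrite -in_fset_set // mem_nth.
have vC : v \in fset_set C by rewrite in_fset_set // mem_set.
have lt_v : (index v (fset_set C) < m.+1)%N by rewrite -cardC index_mem.
by exists (Ordinal lt_v) => //=; apply: nth_index.
Qed.

Section Cells.
Local Open Scope ring_scope.
Variables (R : realType) (O : signature) (S : laws2 O) (r : nat).
Hypothesis hv : valid S r.
Local Notation V := (adm S r).
Local Notation le := (@adm_le O S r).
Local Notation X := (adm_space R S r).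
Local Notation G := (cantor_group hv).
Local Notation act := (@adm_space_act R O S r hv).
Local Notation K := (order_complex le).
Local Notation act_adm := (@adm_act O S r hv).

Let K_finite s : K s -> finite_set s.
Proof. by case. Qed.

Let X_finite (z : X) : finite_set (supp z).
Proof. exact: K_finite (weight_supp z). Qed.

Definition translate (g : G) (C : set V) : set V := act_adm^~ g @` C.

Lemma translate1 C : translate 1%g C = C.
Proof.
by apply/seteqP; split=> [_ [Y CY <-]|Y CY]; [|exists Y]; rewrite // adm_act1.
Qed.

Lemma translateM g h C : translate (g * h)%g C = translate h (translate g C).
Proof.
rewrite /translate image_comp; congr (_ @` _).
by apply/funext => Y; rewrite /= adm_actM.
Qed.

Lemma translateV g C D : translate g C = D -> translate g^-1%g D = C.
Proof. by move<-; rewrite -translateM mulgV translate1. Qed.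

Lemma translate_card g C : finite_set C -> cardf (translate g C) = cardf C.
Proof. exact/cardf_image/adm_act_inj. Qed.

Definition chain_orbit (C : set V) : set (set V) := range (translate^~ C).

Lemma chain_orbit_translate g C : chain_orbit (translate g C) = chain_orbit C.
Proof.
apply/seteqP; split=> [_ [h _ <-]|_ [h _ <-]].
  by exists (g * h)%g; rewrite // translateM.
by exists (g^-1 * h)%g; rewrite // translateM (translateV (erefl _)).
Qed.

(** A cell is the orbit itself, as a set of chains, so that translates of one chain give the same
    cell; [cell_chain] chooses a representative. *)
Definition chain_cell n : Type := {B : set (set V) |
  exists C, [/\ K C, cardf C = n.+1 & B = chain_orbit C]}.

Definition cell_chain n (c : chain_cell n) : set V := sval (cid (svalP c)).

Lemma cell_chainP n (c : chain_cell n) : [/\ K (cell_chain c),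
  cardf (cell_chain c) = n.+1 & sval c = chain_orbit (cell_chain c)].
Proof. exact: svalP (cid (svalP c)). Qed.

Lemma cell_chain_finite n (c : chain_cell n) : finite_set (cell_chain c).
Proof. by case: (cell_chainP c) => /K_finite. Qed.

Lemma cell_chain_card n (c : chain_cell n) : cardf (cell_chain c) = n.+1.
Proof. by case: (cell_chainP c). Qed.

Lemma cell_eq n (c c' : chain_cell n) g :
  cell_chain c' = translate g (cell_chain c) -> c = c'.
Proof.
case: (cell_chainP c) (cell_chainP c') => _ _ ec [_ _ ec'] e.
apply: eq_sig_hprop => [B p q|]; first exact: Prop_irrelevance.
by rewrite ec ec' e chain_orbit_translate.
Qed.

Lemma cell_cover n s : K s -> cardf s = n.+1 ->
  exists (c : chain_cell n) g, s = translate g (cell_chain c).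
Proof.
move=> Ks cs; pose c : chain_cell n :=
  exist _ (chain_orbit s) (ex_intro _ s (And3 Ks cs erefl)).
have [_ _ /= ec] := cell_chainP c; exists c.
have : chain_orbit s s by exists 1%g; rewrite ?translate1.
by rewrite ec => -[g _ <-]; exists g.
Qed.

Lemma cell_enum_ex n (c : chain_cell n) :
  exists e : 'I_n.+1 -> V, injective e /\ range e = cell_chain c.
Proof.
exact: finite_set_enum (cell_chain_finite c) (cell_chain_card c).
Qed.

Definition cell_enum n (c : chain_cell n) : 'I_n.+1 -> V :=
  sval (cid (cell_enum_ex c)).

Lemma cell_enum_inj n (c : chain_cell n) : injective (cell_enum c).
Proof. by case: (svalP (cid (cell_enum_ex c))). Qed.

Lemma cell_enum_range n (c : chain_cell n) : range (cell_enum c) = cell_chain c.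
Proof. by case: (svalP (cid (cell_enum_ex c))). Qed.

(** * The characteristic map of a cell and its inverse *)

Section Char.
Variables (n : nat) (c : chain_cell n).
Local Notation e := (cell_enum c).
Implicit Type x : 'rV[R]_n.

Definition char_weight x v : R := \sum_i bary x i * (e i == v)%:R.

Lemma char_weight_enum x i : char_weight x (e i) = bary x i.
Proof.
rewrite /char_weight (bigD1 i) //= eqxx mulr1 big1 ?addr0 // => j ne_ji.
by rewrite (inj_eq (@cell_enum_inj n c)) (negbTE ne_ji) mulr0.
Qed.

Lemma char_weight_out x v : ~ cell_chain c v -> char_weight x v = 0.
Proof.
rewrite -cell_enum_range => nv; apply: big1 => i _.
by case: eqVneq => [ev|_]; [case: nv; exists i|rewrite mulr0].
Qed.

Fact char_ge0 x v : 0 <= char_weight x v.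
Proof. by apply: sumr_ge0 => i _; rewrite mulr_ge0 ?bary_ge0. Qed.

Fact char_sum x : \sum_(v \in [set: V]) char_weight x v = 1.
Proof.
rewrite (fsum_range (@cell_enum_inj n c)) => [|v]; last first.
  by rewrite cell_enum_range; exact: char_weight_out.
by under eq_bigr do rewrite char_weight_enum; exact: bary_sum.
Qed.

Lemma char_weight_sub x : [set v | char_weight x v != 0] `<=` cell_chain c.
Proof.
move=> v /= nz; apply: contrapT => nv; move/eqP: nz; apply.
exact: char_weight_out.
Qed.

Fact char_supp x : K [set v | char_weight x v != 0].
Proof.
have sub := @char_weight_sub x; have [[_ _ chain] _ _] := cell_chainP c.
split.
- exact: sub_finite_set sub (cell_chain_finite c).
- apply: contrapT => nex; have /eqP := char_sum x.
  rewrite fsbig1 => [|v _]; first by rewrite eq_sym oner_eq0.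
  by apply: contrapT => /eqP nz; apply: nex; exists v.
- by move=> v w /sub cv /sub cw; apply: chain.
Qed.

Definition char_map x : X := Realisation (char_ge0 x) (char_supp x) (char_sum x).

Lemma char_map_supp x : supp (char_map x) `<=` cell_chain c.
Proof. exact: char_weight_sub. Qed.

Lemma char_map_supp_open x : open_disk x -> supp (char_map x) = cell_chain c.
Proof.
move=> x1; apply/seteqP; split; first exact: char_map_supp.
rewrite -cell_enum_range => _ [i _ <-]; rewrite /supp /= char_weight_enum.
by rewrite gt_eqF // bary_gt0.
Qed.

Lemma char_map_continuous : continuous char_map.
Proof.
move=> x; apply: (@cvg_realisation R V K K_finite _ (nbhs x) char_map _
  (cell_chain c)).
- exact: cell_chain_finite.
- by apply: nearW => y; exact: char_map_supp.
- exact: char_map_supp.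
move=> v _; apply: (@cvg_sumr R _ (nbhs x)) => i.
by apply: cvgM; [exact: bary_continuous|exact: cvg_cst].
Qed.

Lemma char_map_fixed x (g : G) : (forall Y, cell_chain c Y -> adm_act Y g = Y) ->
  act (char_map x) g = char_map x.
Proof. by move=> fix_c; apply/act_fixedP => Y /char_map_supp/fix_c. Qed.

(** The inverse of the characteristic map followed by [g]: the weights at the translated vertices
    are read as barycentric coordinates. *)
Definition cell_coord (g : G) (z : X) : 'rV[R]_n :=
  unbary (fun i => z (adm_act (e i) g)).

Lemma cell_coord_sum g (z : X) : supp z `<=` translate g (cell_chain c) ->
  \sum_i z (adm_act (e i) g) = 1.
Proof.
move=> zc; rewrite -(weight_sum z).
rewrite -(@fsum_range _ _ _ (fun i => adm_act (e i) g)) //.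
  by move=> i j /adm_act_inj/cell_enum_inj.
move=> v nv; apply: supp0 => /zc[Y + eY]; rewrite -cell_enum_range => -[i _ ei].
by apply: nv; exists i; rewrite ?ei.
Qed.

Lemma char_map_coord g (z : X) : supp z `<=` translate g (cell_chain c) ->
  disk (cell_coord g z) /\ act (char_map (cell_coord g z)) g = z.
Proof.
move=> zc; have [|dz ez] := unbaryK _ (cell_coord_sum zc).
  by move=> i; apply: weight_ge0.
split=> //; apply: realisation_eq => Y /=.
have [[Y' cY' <-]|nY] := pselect (translate g (cell_chain c) Y).
  rewrite adm_actK; move: cY'; rewrite -cell_enum_range => -[i _ <-].
  by rewrite char_weight_enum ez.
rewrite [z Y]supp0 => [|/zc//]; apply: char_weight_out => cY.
by apply: nY; exists (adm_act Y g^-1%g); rewrite ?adm_actVK.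
Qed.

Lemma cell_coord_open g (z : X) : supp z = translate g (cell_chain c) ->
  open_disk (cell_coord g z).
Proof.
move=> ez; apply: unbary_open_disk; last by apply: cell_coord_sum; rewrite ez.
move=> i; rewrite lt_def weight_ge0 andbT.
have : supp z (adm_act (e i) g); last by [].
by rewrite ez; exists (e i); rewrite // -cell_enum_range; exists i.
Qed.

Lemma cvg_cell_coord g D (z : X) :
  cell_coord g @ near_full D z --> cell_coord g z.
Proof. by apply: cvg_unbary => i; exact: near_full_weight. Qed.

End Char.

(** A simplex with [n] vertices has dimension [n - 1], which matches the index shift in [skel]. *)
Definition skeleton n : set X := [set z | (cardf (supp z) <= n)%N].

(** By [chain_act_fixed] this pointwise stabiliser is also the setwise stabiliser of the chain. *)
Definition chain_stab n (c : chain_cell n) : set G :=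
  [set g | forall Y, cell_chain c Y -> adm_act Y g = Y].

Lemma supp_card_sub (z : X) s n : K s -> (cardf s <= n)%N -> supp z `<=` s ->
  skeleton n z.
Proof.
move=> Ks sn zs; apply: leq_trans sn; apply: fset_set_leq_card => //.
exact: K_finite.
Qed.

Lemma cell_chain_skeleton n (c : chain_cell n) (z : X) g :
  supp z `<=` translate g (cell_chain c) -> skeleton n.+1 z.
Proof.
move=> zc; rewrite /skeleton /=; have finc := cell_chain_finite c.
rewrite -(cell_chain_card c) -(translate_card g finc).
by apply: fset_set_leq_card zc; exact: finite_image.
Qed.

Lemma supp_act_sub (z : X) g s :
  supp z `<=` s -> supp (act z g) `<=` translate g s.
Proof. by rewrite supp_act; apply: image_subset. Qed.

Lemma skeleton_act n (z : X) g : skeleton n z -> skeleton n (act z g).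
Proof.
by rewrite /skeleton /= supp_act cardf_image //; exact: adm_act_inj.
Qed.

Lemma chain_stab_subgroup n (c : chain_cell n) : is_subgroup (chain_stab c).
Proof.
split=> [Y _|g h sg sh Y cY|g sg Y cY]; first exact: adm_act1.
  by rewrite adm_actM sg // sh.
by rewrite -{1}(sg Y cY) adm_actK.
Qed.

Lemma open_skeletonP n (A : set X) : open (A : set (subspace (skeleton n))) <->
  exists2 B : set X, open B & forall z, skeleton n z -> (A z <-> B z).
Proof.
split=> [/open_subspaceP[B oB eAB]|[B oB eAB]].
  exists B => // z nz; have /seteqP[BA AB] := eAB.
  by split=> h; [have [] := AB z (conj h nz)|have [] := BA z (conj h nz)].
apply/open_subspaceP; exists B => //.
by apply/seteqP; split=> z [Az nz]; split=> //; apply/(eAB z nz).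
Qed.

(** Openness is tested on one simplex [s] at a time, and [s] lies in the skeleton of index
    [cardf s], where [A] agrees with an open set. *)
Lemma skeleton_open (A : set X) :
  open A <-> forall n, open (A : set (subspace (skeleton n))).
Proof.
split=> [oA n|oA]; first by apply/open_skeletonP; exists A.
apply/(realisation_openP K_finite) => s t Ks At ts.
have /open_skeletonP[B oB eAB] := oA (cardf s).
have skel_s (z : X) : supp z `<=` s -> skeleton (cardf s) z.
  exact: supp_card_sub.
have [e e0 eB] := (realisation_openP K_finite B).1 oB s t Ks
  ((eAB t (skel_s t ts)).1 At) ts.
exists e => // t' et' tt'; apply/eAB; first by apply: skel_s; rewrite et'.
exact: eB.
Qed.

(** A boundary point has a vanishing barycentric coordinate, so its support misses a vertex of the
    chain. *)
Lemma char_map_sphere n (c : chain_cell n) (x : 'rV[R]_n) :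
  sphere x -> skeleton n (char_map c x).
Proof.
move=> /bary_sphere[i xi]; rewrite /skeleton /= -ltnS -(cell_chain_card c).
apply: (fset_set_ltn_card (x := cell_enum c i)).
- exact: cell_chain_finite.
- exact: char_map_supp.
- by rewrite -cell_enum_range; exists i.
- by rewrite /supp /= char_weight_enum xi eqxx.
Qed.

Lemma char_map_open_disk n (c : chain_cell n) (x : 'rV[R]_n) :
  open_disk x -> ~ skeleton n (char_map c x).
Proof.
by move=> x1; rewrite /skeleton /= char_map_supp_open // cell_chain_card ltnn.
Qed.

Lemma char_map_surj n (z : X) : skeleton n.+1 z -> ~ skeleton n z ->
  exists (c : chain_cell n) (x : 'rV[R]_n) g,
    open_disk x /\ z = act (char_map c x) g.
Proof.
rewrite /skeleton /= => zn1 /negP; rewrite -ltnNge => zn.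
have zn' : cardf (supp z) = n.+1 by apply/eqP; rewrite eqn_leq zn1.
have [c [g ez]] := @cell_cover n (supp z) (weight_supp z) zn'.
exists c, (cell_coord c g z), g; split; first exact: cell_coord_open.
have [|_ eact] := @char_map_coord n c g z; first by rewrite ez.
by rewrite eact.
Qed.

Lemma char_map_inj n (c c' : chain_cell n) (x x' : 'rV[R]_n) (g g' : G) :
  open_disk x -> open_disk x' -> act (char_map c x) g = act (char_map c' x') g' ->
  [/\ c = c', x = x' & chain_stab c (g * g'^-1)%g].
Proof.
(* Interior points have the whole chain as support, so equal images force equal translated
   chains. *)
move=> x1 x1' exx'; have ecc' : translate g (cell_chain c) =
    translate g' (cell_chain c').
  by have := congr1 (@supp _ _ _) exx'; rewrite !supp_act !char_map_supp_open.
have ec' : cell_chain c' = translate (g * g'^-1)%g (cell_chain c).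
  by rewrite translateM ecc' (translateV (erefl _)).
have ec := cell_eq ec'; subst c'.
have stab_c : chain_stab c (g * g'^-1)%g.
  have [Kc _ _] := cell_chainP c; apply: chain_act_fixed Kc _ => Y cY.
  by rewrite ec'; exists Y.
(* Since [g] and [g'] agree on the vertices, comparing the weights there gives equal barycentric
   coordinates. *)
split=> //; rewrite -(baryK (open_disk_sub x1)) -(baryK (open_disk_sub x1')).
congr unbary; apply/funext => i; rewrite -!(char_weight_enum c).
have := congr1 (fun z : X => z (adm_act (cell_enum c i) g)) exx'.
rewrite /= adm_actK -adm_actM stab_c //.
by rewrite -cell_enum_range; exists i.
Qed.

Lemma act_char_map_continuous n (c : chain_cell n) (g : G) :
  continuous (fun x : 'rV[R]_n => act (char_map c x) g : X).
Proof.
move=> x; exact: (continuous_comp (@char_map_continuous n c x)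
  (@adm_space_act_continuous R O S r hv g (char_map c x))).
Qed.

(* On a simplex with n + 1 vertices, cell_coord inverts the characteristic map
   continuously, so that openness is inherited from the disk. *)
Lemma skeletonS_open n (A : set X) :
  open (A : set (subspace (skeleton n.+1))) <->
  open (A : set (subspace (skeleton n))) /\
  forall (c : chain_cell n) g,
    open ([set x | A (act (char_map c x) g)] : set (subspace (@disk R n))).
Proof.
have char_skel (c : chain_cell n) x g : skeleton n.+1 (act (char_map c x) g).
  by apply: (cell_chain_skeleton (g := g)); exact/supp_act_sub/char_map_supp.
split=> [/open_skeletonP[B oB eAB]|[/open_skeletonP[B oB eAB] oAc]].
  split=> [|c g].
    by apply/open_skeletonP; exists B => // z nz; apply: eAB; apply: leqW.
  apply/open_subspaceP; exists [set x | B (act (char_map c x) g)].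
    by have /continuousP := @act_char_map_continuous n c g; apply.
  by apply/seteqP; split=> x [Ax dx]; split=> //; apply/(eAB _ (char_skel c x g)).
(* Adding the complement of the skeleton leaves [A] unchanged on it and makes the test trivial on
   simplices with more than [n.+1] vertices. *)
apply/open_skeletonP; exists (A `|` ~` skeleton n.+1); last first.
  by move=> z nz; split=> [|[]//]; left.
apply/(realisation_openP K_finite) => s t Ks At ts.
have [le_sn|lt_ns] := leqP (cardf s) n.+1; last first.
  exists 1 => // t' et' _; right; rewrite /skeleton /= et'.
  by apply/negP; rewrite -ltnNge.
have {}At : A t by case: At => //; case; exact: supp_card_sub ts.
move: le_sn; rewrite leq_eqVlt => /predU1P[cs|le_sn].
  (* A simplex with exactly [n.+1] vertices is a translated cell, where [A] is pulled back from the
     disk along [cell_coord]. *)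
  have [c [g es]] := cell_cover Ks cs; rewrite es in ts *.
  have [dt et] := char_map_coord ts.
  have /open_subspaceP[U oU eUA] := oAc c g; have /seteqP[UA AU] := eUA.
  have [Ut _] : (U `&` disk (n:=n)) (cell_coord c g t).
    by apply: AU; split=> //=; rewrite et.
  have [e e0 eU] := @cvg_cell_coord n c g s t U
    (open_nbhs_nbhs (conj oU Ut)).
  exists e => // t' et' tt'; left.
  have [|dt' et''] := @char_map_coord n c g t'; first by rewrite et'.
  rewrite -et''; have [//|//] := UA (cell_coord c g t').
  by split=> //; apply: eU => //; rewrite et' es.
(* A smaller simplex lies in the lower skeleton, where [A] agrees with the open set [B]. *)
have skel_s (z : X) : supp z `<=` s -> skeleton n z by exact: supp_card_sub.
have [e e0 eB] := (realisation_openP K_finite B).1 oB s t Ks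
  ((eAB t (skel_s t ts)).1 At) ts.
exists e => // t' et' tt'; left; apply/eAB; first by apply: skel_s; rewrite et'.
exact: eB.
Qed.

Lemma adm_space_GCW : inhabited (GCW_structure R (Z := X) act).
Proof.
have skel0 : skeleton 0 = set0.
  apply/seteqP; split=> // z; rewrite /skeleton /= leqn0 => /eqP/cardfs0_eq z0.
  have [_ [Y zY] _] := weight_supp z.
  by have /(fset_set_set0 (X_finite z)) sz := z0; have : supp z Y by [];
    rewrite sz.
exists; apply: (@Build_GCW_structure R G X act skeleton chain_cell chain_stab
  (fun n c => char_map c)).
- exact: skel0.
- by move=> n z; apply: leqW.
- by move=> n z g; apply: skeleton_act.
- by apply/seteqP; split=> // z _; exists (cardf (supp z)) => //=; apply: leqnn.
- exact: skeleton_open.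
- exact: chain_stab_subgroup.
- by move=> n c x h _ ch; apply: char_map_fixed.
- move=> n c x _; apply: (cell_chain_skeleton (c := c) (g := 1%g)).
  by rewrite translate1; exact: char_map_supp.
- exact: char_map_sphere.
- exact: char_map_open_disk.
- exact: char_map_surj.
- exact: char_map_inj.
- exact: skeletonS_open.
Qed.

End Cells.

Theorem theorem3p1 (R : realType) (O : signature) (S : laws2 O) (r : nat)
    (r_gt0 : (0 < r)%N) (hv : valid S r) (hb : bounded S r) :
  is_EG_model R (@adm_space_act R O S r hv).
Proof.
split; [exact: adm_space_Gspace|exact: adm_space_GCW|move=> H sgH].
split=> [finH|infH]; first exact (fixed_points_contractible R hb sgH finH).
exact: fixed_points_infinite.
Qed.
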